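(* Let $\lambda_0<\lambda_1$ and $\lambda_2$ be three distinct real numbers and let $a<b$. For each $n\ge2$ let $\Lambda_n=(\lambda_0,\lambda_1,\lambda_2,\lambda_3^{(n)},\dots,\lambda_n^{(n)})\in\mathbb{C}^{n+1}$, where the entries $\lambda_j^{(n)}$, $j\ge3$, may depend on $n$. Suppose each $E_{\Lambda_n}$ is closed under complex conjugation and there is $M>0$ with $|\mathrm{Im}\,\lambda_j^{(n)}|\le M$ for all $n$ and $j$, and that $b-a<\pi/M$. For $k=0,\dots,n-1$ let $$b(n,k):=\lim_{x\to b}\frac{p_{(\lambda_0,\lambda_1,\lambda_3^{(n)},\dots,\lambda_n^{(n)}),k}(x)}{p_{(\lambda_1,\lambda_2,\lambda_3^{(n)},\dots,\lambda_n^{(n)}),k}(x)}$$ (a positive real number), and let $t_k=t_k^{(n)}$, $k=0,\dots,n$, be the nodes of the Bernstein operator $B_{\Lambda_n}$ associated with $\Lambda_n$ and $[a,b]$ as described below. Assume that $t_k^{(n)}-t_{k-1}^{(n)}\to0$ as $n\to\infty$ uniformly in $k$, and that $$\lim_{n\to\infty}\frac{\log b(n,k)}{t_k^{(n)}-t_{k+1}^{(n)}}=\lambda_2-\lambda_0$$ uniformly in $k$. Then for every $f\in C([a,b],\mathbb{C})$, $B_{\Lambda_n}f\to f$ uniformly on $[a,b]$ as $n\to\infty$.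
   Context: For $\mu=(\mu_0,\dots,\mu_m)\in\mathbb{C}^{m+1}$, $E_\mu$ denotes the space of all $f\in C^\infty(\mathbb{R},\mathbb{C})$ with $(\frac{d}{dx}-\mu_0)\cdots(\frac{d}{dx}-\mu_m)f=0$ (dimension $m+1$, independent of the ordering); it is closed under complex conjugation if $\overline f\in E_\mu$ whenever $f\in E_\mu$. A zero of order (exactly) $k$ at $a$ means $f(a)=\dots=f^{(k-1)}(a)=0$, $f^{(k)}(a)\neq0$. Under the hypotheses, all spaces involved are extended Chebyshev systems over $[a,b]$ (each nonzero element has at most $m$ zeros in $[a,b]$ with multiplicity), so each has a Bernstein basis $p_{\mu,k}$, $k=0,\dots,m$, w.r.t. $a,b$: the unique family in $E_\mu$ with a zero of order exactly $k$ at $a$, exactly $m-k$ at $b$, and $p_{\mu,k}^{(k)}(a)=1$. The Bernstein operator of $\Lambda=(\lambda_0,\dots,\lambda_n)$ (with $\lambda_0<\lambda_1$ real) is $B_\Lambda f=\sum_{k=0}^n\alpha_kf(t_k)p_{\Lambda,k}$, where $t_0=a$, $e^{(\lambda_0-\lambda_1)(t_k-t_{k-1})}=\lim_{x\to b}p_{(\lambda_0,\lambda_2,\dots,\lambda_n),k-1}(x)/p_{(\lambda_1,\dots,\lambda_n),k-1}(x)$ for $k=1,\dots,n$, $\alpha_0=1$ and $\alpha_k=e^{-\lambda_0(t_k-a)}(-1)^k\prod_{l=0}^{k-1}\lim_{x\to b}\frac{d}{dx}p_{\Lambda,l}(x)/p_{(\lambda_1,\dots,\lambda_n),l}(x)$;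 these satisfy $a=t_0<\dots<t_n=b$, $\alpha_k>0$, and $B_\Lambda$ fixes $e^{\lambda_0x}$ and $e^{\lambda_1x}$. *)

(* Defs.v *)
From Stdlib Require Import Reals Lra Lia List ClassicalEpsilon.
Import ListNotations.
Open Scope R_scope.

Record Cx := mkCx { cre : R; cim : R }.

Definition C0 : Cx := mkCx 0 0.
Definition C1 : Cx := mkCx 1 0.
Definition RtoC (r : R) : Cx := mkCx r 0.
Definition Cadd (z w : Cx) : Cx := mkCx (cre z + cre w) (cim z + cim w).
Definition Copp (z : Cx) : Cx := mkCx (- cre z) (- cim z).
Definition Csub (z w : Cx) : Cx := Cadd z (Copp w).
Definition Cmul (z w : Cx) : Cx :=
  mkCx (cre z * cre w - cim z * cim w) (cre z * cim w + cim z * cre w).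
Definition Cinv (z : Cx) : Cx :=
  mkCx (cre z / (cre z ^ 2 + cim z ^ 2)) (- cim z / (cre z ^ 2 + cim z ^ 2)).
Definition Cdiv (z w : Cx) : Cx := Cmul z (Cinv w).
Definition Cconj (z : Cx) : Cx := mkCx (cre z) (- cim z).
Definition Cmod (z : Cx) : R := sqrt (cre z ^ 2 + cim z ^ 2).

Definition Csum (l : list Cx) : Cx := fold_right Cadd C0 l.
Definition Cprod (l : list Cx) : Cx := fold_right Cmul C1 l.

Lemma Cx_inhabited : inhabited Cx. Proof. exact (inhabits C0). Qed.
Lemma CxFun_inhabited : inhabited (R -> Cx). Proof. exact (inhabits (fun _ => C0)). Qed.
Lemma R_inhabited : inhabited R. Proof. exact (inhabits 0). Qed.

Definition is_derive_C (f g : R -> Cx) : Prop :=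
  forall x, derivable_pt_lim (fun y => cre (f y)) x (cre (g x)) /\
            derivable_pt_lim (fun y => cim (f y)) x (cim (g x)).

(* F is a tower of successive derivatives: F (k+1) = (F k)' ; F 0 is then C^infinity *)
Definition deriv_tower (F : nat -> R -> Cx) : Prop :=
  forall k, is_derive_C (F k) (F (S k)).

(* the derivative of f (chosen; unique when it exists) *)
Definition derivC (f : R -> Cx) : R -> Cx :=
  epsilon CxFun_inhabited (fun g => is_derive_C f g).

Definition opD (mu : Cx) (F : nat -> R -> Cx) : nat -> R -> Cx :=
  fun k x => Csub (F (S k) x) (Cmul mu (F k x)).

Definition applyOps (mus : list Cx) (F : nat -> R -> Cx) : nat -> R -> Cx :=
  fold_right opD F mus.

Definition inE (mus : list Cx) (f : R -> Cx) : Prop :=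
  exists F, deriv_tower F /\ F 0%nat = f /\ forall x, applyOps mus F 0%nat x = C0.

Definition closed_conj (mus : list Cx) : Prop :=
  forall f, inE mus f -> inE mus (fun x => Cconj (f x)).

(* p is the k-th Bernstein basis element of E_mu w.r.t. a, b (m = length mus - 1):
   zero of order exactly k at a with p^(k)(a) = 1, zero of order exactly m-k at b *)
Definition is_bernstein (a b : R) (mus : list Cx) (k : nat) (p : R -> Cx) : Prop :=
  inE mus p /\
  exists F, deriv_tower F /\ F 0%nat = p /\
    (forall j, (j < k)%nat -> F j a = C0) /\ F k a = C1 /\
    (forall j, (j < length mus - 1 - k)%nat -> F j b = C0) /\
    F (length mus - 1 - k)%nat b <> C0.

(* the (unique) Bernstein basis element p_{mu,k} *)
Definition bern (a b : R) (mus : list Cx) (k : nat) : R -> Cx :=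
  epsilon CxFun_inhabited (is_bernstein a b mus k).

Definition is_lim_left (g : R -> Cx) (b : R) (L : Cx) : Prop :=
  forall eps, eps > 0 -> exists d, d > 0 /\
    forall x, b - d < x < b -> Cmod (Csub (g x) L) < eps.

Definition limL (g : R -> Cx) (b : R) : Cx :=
  epsilon Cx_inhabited (is_lim_left g b).

(* ---------- Bernstein operator of Lambda = (l0, l1, rest) with rest = (lambda_2..lambda_n) ---------- *)

(* the limit defining e^{(l0-l1)(t_k - t_{k-1})}, for k >= 1 *)
Definition node_ratio (a b l0 l1 : R) (rest : list Cx) (k : nat) : Cx :=
  limL (fun x => Cdiv (bern a b (RtoC l0 :: rest) (k - 1) x)
                      (bern a b (RtoC l1 :: rest) (k - 1) x)) b.

Definition node_step (a b l0 l1 : R) (rest : list Cx) (k : nat) : R :=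
  epsilon R_inhabited
    (fun d => RtoC (exp ((l0 - l1) * d)) = node_ratio a b l0 l1 rest k).

Fixpoint node (a b l0 l1 : R) (rest : list Cx) (k : nat) : R :=
  match k with
  | O => a
  | S k' => node a b l0 l1 rest k' + node_step a b l0 l1 rest k
  end.

Definition bcoef (a b l0 l1 : R) (rest : list Cx) (k : nat) : Cx :=
  Cmul (RtoC (exp (- l0 * (node a b l0 l1 rest k - a)) * (-1) ^ k))
       (Cprod (map (fun l =>
          limL (fun x => Cdiv (derivC (bern a b (RtoC l0 :: RtoC l1 :: rest) l) x)
                              (bern a b (RtoC l1 :: rest) l x)) b) (seq 0 k))).

(* B_Lambda f, with Lambda = (l0, l1, rest), n = length rest + 1 *)
Definition bernstein_op (a b l0 l1 : R) (rest : list Cx) (f : R -> Cx) : R -> Cx :=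
  fun x => Csum (map (fun k =>
     Cmul (Cmul (bcoef a b l0 l1 rest k) (f (node a b l0 l1 rest k)))
          (bern a b (RtoC l0 :: RtoC l1 :: rest) k x))
     (seq 0 (length rest + 2))).

Definition contC_on (a b : R) (f : R -> Cx) : Prop :=
  forall x, a <= x <= b -> forall eps, eps > 0 -> exists d, d > 0 /\
    forall y, a <= y <= b -> Rabs (y - x) < d -> Cmod (Csub (f y) (f x)) < eps.

(* Main.v *)
From Stdlib Require Import Reals Lra Lia Wf_nat Compare_dec Factorial List Permutation.
From Stdlib Require Import FunctionalExtensionality ClassicalEpsilon.
From Coquelicot Require Import Rcomplements Hierarchy Derive RInt RInt_analysis AutoDerive.
Require Import Defs.
Import ListNotations.
Open Scope R_scope.

(** The real exponential spaces involved form extended Chebyshev systems on [a,b]: conjugate pairs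
    of frequencies give second-order operators which factor through the positive function
    e^{al x} cos (be (x - c)), c the midpoint, because b - a < pi / M, and Rolle's theorem then
    counts zeros. Writing P_k for the Bernstein basis of Lambda and Q_k for that of Lambda without
    a real entry l, one has (D - l) P_k = Q_{k-1} + d_k Q_k, where d_k is a ratio of derivatives at b.
    Telescoping gives e^{l x} = e^{l a} sum_k (-d_0) ... (-d_{k-1}) P_k(x). For l = l0 and l = l1
    these coefficients are alpha_k e^{l t_k}, so the positive operator B fixes both exponentials;
    for l = l2 they are alpha_k e^{l2 t_k + eta_k}, where eta_k is controlled by the hypothesis on
    log b(n,k). Hence B e^{l2 x} converges uniformly to e^{l2 x}, and a Korovkin argument for the
    Chebyshev system e^{l0 x}, e^{l1 x}, e^{l2 x} concludes. *)

(** * Exponential spaces and conjugate pairs *)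

(** [bern], [derivC], [limL] and [node_step] are picked by [epsilon], so each must first be shown to
    exist and be determined; from then on only real towers [P k j x], the j-th derivative of P_k at
    x, are handled. Identities between basis elements are not computed: both sides lie in a space of
    dimension N, and N zeros at the two endpoints force their difference to vanish on [a,b]. The
    ratio b(n,k) is d0_k / d2_k, since d0_k and d2_k share as numerator the same derivative of P_k
    at b. Up to a constant, passing from the coefficients of e^{l0 x} to those of e^{l2 x} thus
    multiplies the k-th one by the product of the 1 / b(n,j), j < k, and by hypothesis -log b(n,j)
    is (l2 - l0)(t_{j+1} - t_j) up to a small multiple of the step. The steps sum to b - a, so eta_k
    is small whatever the number of factors. Only the first two exponentials are reproduced exactly,
    so the Korovkin argument must tolerate an error in the third, with a threshold depending on f
    and eps but not on n, the nodes or the weights. *)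

Lemma Cx_eq (z w : Cx) : cre z = cre w -> cim z = cim w -> z = w.
Proof. destruct z, w; simpl; intros; subst; reflexivity. Qed.

Lemma Cx_ring_theory : ring_theory C0 C1 Cadd Cmul Csub Copp eq.
Proof. constructor; intros; apply Cx_eq; simpl; ring. Qed.
Add Ring Cx_ring : Cx_ring_theory.

Lemma Cmul_integral (z w : Cx) : Cmul z w = C0 -> z = C0 \/ w = C0.
Proof.
  destruct z as [x y], w as [u v]; intros H; injection H as H1 H2; simpl in *.
  assert (H3 : (x * x + y * y) * (u * u + v * v) = 0).
  { replace ((x * x + y * y) * (u * u + v * v))
      with ((x * u - y * v) ^ 2 + (x * v + y * u) ^ 2) by ring.
    rewrite H1, H2; ring. }
  apply Rmult_integral in H3; destruct H3 as [H3 | H3];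
    apply Rplus_sqr_eq_0 in H3; destruct H3; subst; [left | right]; reflexivity.
Qed.

(** * Derivatives and towers of complex-valued functions *)

Lemma derivable_pt_lim_value (f : R -> R) (x l l' : R) :
  derivable_pt_lim f x l -> l = l' -> derivable_pt_lim f x l'.
Proof. intros H <-; exact H. Qed.

Lemma derivable_pt_lim_lincomb (c d : R) (f g : R -> R) (x l m : R) :
  derivable_pt_lim f x l -> derivable_pt_lim g x m ->
  derivable_pt_lim (fun y => c * f y + d * g y) x (c * l + d * m).
Proof.
  intros Hf Hg.
  apply (derivable_pt_lim_plus (fun y => c * f y) (fun y => d * g y));
    [apply (derivable_pt_lim_scal f) | apply (derivable_pt_lim_scal g)]; assumption.
Qed.

Lemma derivable_pt_lim_continuity (f : R -> R) (x l : R) :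
  derivable_pt_lim f x l -> continuity_pt f x.
Proof. intros H; apply derivable_continuous_pt; exists l; exact H. Qed.

Lemma is_derive_C_add (f g f' g' : R -> Cx) :
  is_derive_C f f' -> is_derive_C g g' ->
  is_derive_C (fun x => Cadd (f x) (g x)) (fun x => Cadd (f' x) (g' x)).
Proof.
  intros Hf Hg x; destruct (Hf x) as [F1 F2], (Hg x) as [G1 G2]; split; simpl.
  - exact (derivable_pt_lim_plus _ _ _ _ _ F1 G1).
  - exact (derivable_pt_lim_plus _ _ _ _ _ F2 G2).
Qed.

Lemma is_derive_C_mul (f g f' g' : R -> Cx) :
  is_derive_C f f' -> is_derive_C g g' ->
  is_derive_C (fun x => Cmul (f x) (g x))
    (fun x => Cadd (Cmul (f' x) (g x)) (Cmul (f x) (g' x))).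
Proof.
  intros Hf Hg x; destruct (Hf x) as [F1 F2], (Hg x) as [G1 G2]; split; simpl.
  - eapply derivable_pt_lim_value.
    + exact (derivable_pt_lim_minus _ _ _ _ _ (derivable_pt_lim_mult _ _ _ _ _ F1 G1)
               (derivable_pt_lim_mult _ _ _ _ _ F2 G2)).
    + cbv beta; ring.
  - eapply derivable_pt_lim_value.
    + exact (derivable_pt_lim_plus _ _ _ _ _ (derivable_pt_lim_mult _ _ _ _ _ F1 G2)
               (derivable_pt_lim_mult _ _ _ _ _ F2 G1)).
    + cbv beta; ring.
Qed.

Lemma is_derive_C_const (c : Cx) : is_derive_C (fun _ => c) (fun _ => C0).
Proof. intros x; split; apply derivable_pt_lim_const. Qed.

Lemma is_derive_C_scal (c : Cx) (f f' : R -> Cx) :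
  is_derive_C f f' -> is_derive_C (fun x => Cmul c (f x)) (fun x => Cmul c (f' x)).
Proof.
  intros Hf.
  replace (fun x => Cmul c (f' x))
    with (fun x => Cadd (Cmul C0 (f x)) (Cmul c (f' x)))
    by (extensionality x; ring).
  exact (is_derive_C_mul _ _ _ _ (is_derive_C_const c) Hf).
Qed.

Lemma is_derive_C_conj (f f' : R -> Cx) :
  is_derive_C f f' -> is_derive_C (fun x => Cconj (f x)) (fun x => Cconj (f' x)).
Proof.
  intros Hf x; destruct (Hf x) as [F1 F2]; split; simpl.
  - exact F1.
  - exact (derivable_pt_lim_opp _ _ _ F2).
Qed.

Lemma is_derive_C_unique (f g h : R -> Cx) : is_derive_C f g -> is_derive_C f h -> g = h.
Proof.
  intros Hg Hh; extensionality x; destruct (Hg x), (Hh x).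
  apply Cx_eq; eapply uniqueness_limite; eassumption.
Qed.

Lemma derivC_unique (f g : R -> Cx) : is_derive_C f g -> derivC f = g.
Proof.
  intros H; apply (is_derive_C_unique f); [| exact H].
  apply (epsilon_spec CxFun_inhabited (fun g => is_derive_C f g)); exists g; exact H.
Qed.

(** [inE] and [is_bernstein] each assert a tower of their own over the same function; this
    identifies them, so that facts about one tower pass to the other. *)
Lemma deriv_tower_unique (F G : nat -> R -> Cx) :
  deriv_tower F -> deriv_tower G -> F 0%nat = G 0%nat -> F = G.
Proof.
  intros HF HG H0; extensionality k; induction k as [| k IH]; [exact H0 |].
  apply (is_derive_C_unique (F k)); [apply HF | rewrite IH; apply HG].
Qed.

Definition conj_tower (F : nat -> R -> Cx) : nat -> R -> Cx := fun k x => Cconj (F k x).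

Lemma deriv_tower_conj (F : nat -> R -> Cx) : deriv_tower F -> deriv_tower (conj_tower F).
Proof. intros HF k; exact (is_derive_C_conj _ _ (HF k)). Qed.

Lemma deriv_tower_opD (l : Cx) (F : nat -> R -> Cx) : deriv_tower F -> deriv_tower (opD l F).
Proof.
  intros HF k; unfold opD.
  replace (fun x => Csub (F (S k) x) (Cmul l (F k x)))
    with (fun x => Cadd (F (S k) x) (Cmul (Copp l) (F k x)))
    by (extensionality x; ring).
  replace (fun x => Csub (F (S (S k)) x) (Cmul l (F (S k) x)))
    with (fun x => Cadd (F (S (S k)) x) (Cmul (Copp l) (F (S k) x)))
    by (extensionality x; ring).
  apply is_derive_C_add; [apply HF | apply is_derive_C_scal, HF].
Qed.

Lemma opD_comm (l m : Cx) (F : nat -> R -> Cx) : opD l (opD m F) = opD m (opD l F).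
Proof. extensionality k; extensionality x; unfold opD; ring. Qed.

Lemma applyOps_perm (mus nus : list Cx) (F : nat -> R -> Cx) :
  Permutation mus nus -> applyOps mus F = applyOps nus F.
Proof.
  induction 1; simpl; [reflexivity | f_equal; assumption | apply opD_comm | congruence].
Qed.

Lemma applyOps_app (mus nus : list Cx) (F : nat -> R -> Cx) :
  applyOps (mus ++ nus) F = applyOps mus (applyOps nus F).
Proof. apply fold_right_app. Qed.

(** [applyOps] lets the head of the list act last. Since the factors commute it may also act first,
    which is what an induction lowering the order of the equation peels off. *)
Lemma applyOps_cons_inner (l : Cx) (mus : list Cx) (F : nat -> R -> Cx) :
  applyOps (l :: mus) F = applyOps mus (opD l F).
Proof.
  rewrite (applyOps_perm (l :: mus) (mus ++ [l])) by apply Permutation_cons_append.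
  apply applyOps_app.
Qed.

Lemma inE_perm (mus nus : list Cx) (f : R -> Cx) :
  Permutation mus nus -> inE mus f -> inE nus f.
Proof.
  intros Hp [F [HF [H0 H]]]; exists F; split; [exact HF | split; [exact H0 |]].
  intros x; rewrite <- (applyOps_perm _ _ F Hp); apply H.
Qed.

Lemma closed_conj_perm (mus nus : list Cx) :
  Permutation mus nus -> closed_conj mus -> closed_conj nus.
Proof.
  intros Hp H f Hf; apply (inE_perm mus nus _ Hp), H, (inE_perm nus mus); [| exact Hf].
  apply Permutation_sym, Hp.
Qed.

(** * Solving (D - l) F = G and initial value problems *)

Lemma continuous_antiderivative (f : R -> R) (a : R) :
  (forall x, continuity_pt f x) ->
  exists I, I a = 0 /\ forall x, derivable_pt_lim I x (f x).
Proof.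
  intros Hf; exists (fun x => RInt f a x); split.
  - exact (RInt_point a f).
  - intros x; apply is_derive_Reals.
    apply (is_derive_RInt f (fun y => RInt f a y) a x).
    + exists (mkposreal 1 Rlt_0_1); intros y _.
      apply (RInt_correct f), (ex_RInt_continuous f).
      intros z _; apply continuity_pt_filterlim, Hf.
    + apply continuity_pt_filterlim, Hf.
Qed.

Definition cexp (l : Cx) (x : R) : Cx :=
  mkCx (exp (cre l * x) * cos (cim l * x)) (exp (cre l * x) * sin (cim l * x)).

Lemma is_derive_C_cexp (l : Cx) : is_derive_C (cexp l) (fun x => Cmul l (cexp l x)).
Proof.
  intros x; split; simpl; apply is_derive_Reals; auto_derive; auto; ring.
Qed.

Lemma cexp_0 (l : Cx) : cexp l 0 = C1.
Proof.
  apply Cx_eq; simpl; rewrite !Rmult_0_r, exp_0; [rewrite cos_0 | rewrite sin_0]; ring.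
Qed.

Lemma cexp_opp (l : Cx) (x : R) : Cmul (cexp l x) (cexp (Copp l) x) = C1.
Proof.
  assert (He : exp (cre l * x) * exp (- cre l * x) = 1).
  { rewrite <- exp_plus; replace (cre l * x + - cre l * x) with 0 by ring; apply exp_0. }
  assert (Ht := sin2_cos2 (cim l * x)); unfold Rsqr in Ht.
  apply Cx_eq; simpl; rewrite ?Ropp_mult_distr_l_reverse, ?cos_neg, ?sin_neg in *.
  - transitivity (exp (cre l * x) * exp (- (cre l * x)) *
      (sin (cim l * x) * sin (cim l * x) + cos (cim l * x) * cos (cim l * x))); [ring |].
    rewrite He, Ht; ring.
  - ring.
Qed.

(* Variation of constants; the higher levels of the tower follow from [F' = l F + G]. *)
Lemma opD_surjective (l : Cx) (a : R) (c : Cx) (G : nat -> R -> Cx) :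
  deriv_tower G ->
  exists F, deriv_tower F /\ F 0%nat a = c /\ opD l F = G.
Proof.
  intros HG.
  set (g := fun x => Cmul (cexp (Copp l) x) (G 0%nat x)).
  assert (Hg := is_derive_C_mul _ _ _ _ (is_derive_C_cexp (Copp l)) (HG 0%nat)).
  destruct (continuous_antiderivative (fun x => cre (g x)) a) as [I1 [Ia1 HI1]].
  { intros x; exact (derivable_pt_lim_continuity _ _ _ (proj1 (Hg x))). }
  destruct (continuous_antiderivative (fun x => cim (g x)) a) as [I2 [Ia2 HI2]].
  { intros x; exact (derivable_pt_lim_continuity _ _ _ (proj2 (Hg x))). }
  set (I := fun x => Cadd (Cmul c (cexp (Copp l) a)) (mkCx (I1 x) (I2 x))).
  assert (HI : is_derive_C I g).
  { unfold I; replace g with (fun x => Cadd C0 (g x)) by (extensionality x; ring).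
    apply (is_derive_C_add (fun _ => Cmul c (cexp (Copp l) a)) (fun x => mkCx (I1 x) (I2 x))).
    - apply is_derive_C_const.
    - intros x; split; [apply HI1 | apply HI2]. }
  set (f := fun x => Cmul (cexp l x) (I x)).
  assert (Hf : is_derive_C f (fun x => Cadd (Cmul l (f x)) (G 0%nat x))).
  { replace (fun x => Cadd (Cmul l (f x)) (G 0%nat x))
      with (fun x => Cadd (Cmul (Cmul l (cexp l x)) (I x)) (Cmul (cexp l x) (g x))).
    - apply is_derive_C_mul; [apply is_derive_C_cexp | exact HI].
    - extensionality x; unfold f, g.
      transitivity (Cadd (Cmul l (Cmul (cexp l x) (I x)))
        (Cmul (Cmul (cexp l x) (cexp (Copp l) x)) (G 0%nat x))); [ring |].
      rewrite cexp_opp; ring. }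
  set (F := fix F k := match k with
    | O => f
    | S k' => fun x => Cadd (Cmul l (F k' x)) (G k' x) end).
  exists F; split; [| split].
  - intros k; induction k as [| k IH]; [exact Hf |].
    apply (is_derive_C_add (fun x => Cmul l (F k x)) (G k)); [| apply HG].
    apply is_derive_C_scal, IH.
  - simpl; unfold f, I.
    replace (mkCx (I1 a) (I2 a)) with C0 by (rewrite Ia1, Ia2; reflexivity).
    transitivity (Cmul c (Cmul (cexp l a) (cexp (Copp l) a))); [ring |].
    rewrite cexp_opp; ring.
  - extensionality k; extensionality x; unfold opD; simpl; ring.
Qed.

Lemma applyOps_surjective (mus : list Cx) (G : nat -> R -> Cx) :
  deriv_tower G -> exists F, deriv_tower F /\ applyOps mus F = G.
Proof.
  revert G; induction mus as [| l mus IH]; intros G HG.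
  - exists G; split; [exact HG | reflexivity].
  - destruct (opD_surjective l 0 C0 G HG) as [H [HH [_ <-]]].
    destruct (IH H HH) as [F [HF <-]]; exists F; split; [exact HF | reflexivity].
Qed.

Lemma initial_value_problem (a : R) (mus : list Cx) (c : nat -> Cx) :
  exists F, deriv_tower F /\ (forall k x, applyOps mus F k x = C0) /\
    forall j, (j < length mus)%nat -> F j a = c j.
Proof.
  revert c; induction mus as [| l mus IH]; intros c.
  - exists (fun _ _ => C0); split; [| split].
    + intros k; apply is_derive_C_const.
    + reflexivity.
    + simpl; intros; lia.
  (* The j-th derivative of (D - l) F at a is F_{j+1}(a) - l F_j(a); with these data for G, those of
     F follow from F(a) = c_0. *)
  - destruct (IH (fun j => Csub (c (S j)) (Cmul l (c j)))) as [G [HG [HG0 HGa]]].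
    destruct (opD_surjective l a (c 0%nat) G HG) as [F [HF [Fa HFG]]].
    exists F; split; [exact HF | split].
    + intros k x; rewrite applyOps_cons_inner, HFG; apply HG0.
    + intros j; induction j as [| j IHj]; simpl; intros Hj; [exact Fa |].
      assert (E : opD l F j a = G j a) by (rewrite HFG; reflexivity).
      unfold opD in E; rewrite HGa, IHj in E by (simpl; lia).
      transitivity (Cadd (Csub (F (S j) a) (Cmul l (c j))) (Cmul l (c j))); [ring |].
      rewrite E; ring.
Qed.

(** A function f of E_mus is lifted to some G whose image under nus is f. Then G lies in the larger
    space, hence so does its conjugate, and nus sends the latter to the conjugate of f. *)
Lemma closed_conj_app (nus mus : list Cx) :
  (forall F, applyOps nus (conj_tower F) = conj_tower (applyOps nus F)) ->
  closed_conj (nus ++ mus) -> closed_conj mus.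
Proof.
  intros Hnus Hcl f [F [HF [F0 HF0]]].
  destruct (applyOps_surjective nus F HF) as [G [HG HGF]].
  assert (E : forall H, applyOps (nus ++ mus) H = applyOps mus (applyOps nus H)).
  { intros H; rewrite (applyOps_perm _ (mus ++ nus)) by apply Permutation_app_comm.
    apply applyOps_app. }
  destruct (Hcl (G 0%nat)) as [H [HH [H0 HH0]]].
  { exists G; split; [exact HG | split; [reflexivity |]].
    intros x; rewrite E, HGF; apply HF0. }
  assert (EH : H = conj_tower G).
  { apply deriv_tower_unique; [exact HH | apply deriv_tower_conj, HG | exact H0]. }
  exists (conj_tower F); split; [apply deriv_tower_conj, HF | split].
  - rewrite <- F0; reflexivity.
  - intros x; rewrite <- HGF, <- Hnus, <- EH, <- E; apply HH0.
Qed.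

(** * Exponentials in E_mu and matching of conjugate frequencies *)

Fixpoint Cpow (z : Cx) (k : nat) : Cx :=
  match k with O => C1 | S k' => Cmul z (Cpow z k') end.

Definition exp_tower (l : Cx) : nat -> R -> Cx := fun k x => Cmul (Cpow l k) (cexp l x).

Lemma deriv_tower_exp (l : Cx) : deriv_tower (exp_tower l).
Proof.
  intros k; unfold exp_tower; simpl.
  replace (fun x => Cmul (Cmul l (Cpow l k)) (cexp l x))
    with (fun x => Cmul (Cpow l k) (Cmul l (cexp l x))) by (extensionality x; ring).
  apply is_derive_C_scal, is_derive_C_cexp.
Qed.

Lemma applyOps_exp_tower (mus : list Cx) (l : Cx) (k : nat) (x : R) :
  applyOps mus (exp_tower l) k x
  = Cmul (Cprod (map (fun m => Csub l m) mus)) (exp_tower l k x).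
Proof.
  revert k; induction mus as [| m mus IH]; intros k.
  - simpl; ring.
  - change (applyOps (m :: mus) (exp_tower l)) with (opD m (applyOps mus (exp_tower l))).
    unfold opD; rewrite !IH; unfold exp_tower; simpl; ring.
Qed.

(** The operator multiplies e^{l x} by the product of the l - m, so its vanishing at 0 kills one
    factor. Frequencies are thereby read off from the function space, which is where closure under
    conjugation is stated. *)
Lemma inE_exp_mem (mus : list Cx) (l : Cx) : inE mus (cexp l) <-> In l mus.
Proof.
  assert (H0 : exp_tower l 0%nat = cexp l)
    by (extensionality y; unfold exp_tower; simpl; ring).
  split.
  - intros [F [HF [F0 H]]].
    assert (E : F = exp_tower l).
    { apply deriv_tower_unique; [exact HF | apply deriv_tower_exp | congruence]. }
    specialize (H 0); rewrite E, applyOps_exp_tower, H0, cexp_0 in H.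
    replace (Cmul (Cprod (map (fun m => Csub l m) mus)) C1)
      with (Cprod (map (fun m => Csub l m) mus)) in H by ring.
    revert H; induction mus as [| m mus IH]; simpl; intros H.
    + apply (f_equal cre) in H; simpl in H; lra.
    + destruct (Cmul_integral _ _ H) as [H1 | H1]; [left | right; apply IH, H1].
      transitivity (Csub l (Csub l m)); [ring | rewrite H1; ring].
  - intros Hl; exists (exp_tower l).
    split; [apply deriv_tower_exp | split; [exact H0 |]].
    intros x; rewrite applyOps_exp_tower.
    replace (Cprod (map (fun m => Csub l m) mus)) with C0; [ring |].
    induction mus as [| m mus IH]; simpl in *; [contradiction |].
    destruct Hl as [-> | Hl]; [ring | rewrite <- IH by exact Hl; ring].
Qed.

Lemma conj_mem (mus : list Cx) (l : Cx) : closed_conj mus -> In l mus -> In (Cconj l) mus.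
Proof.
  intros Hcl Hl; apply inE_exp_mem.
  replace (cexp (Cconj l)) with (fun x => Cconj (cexp l x)).
  - apply Hcl, inE_exp_mem, Hl.
  - extensionality x; apply Cx_eq; simpl;
      rewrite ?Ropp_mult_distr_l_reverse, ?cos_neg, ?sin_neg; ring.
Qed.

(** Conjugate partners are adjacent so that an induction can treat their two factors as one real
    second-order operator; closure under permutation brings any pair into that position. *)
Inductive paired (M : R) : list Cx -> Prop :=
| paired_nil : paired M []
| paired_real (l : R) (mus : list Cx) : paired M mus -> paired M (RtoC l :: mus)
| paired_pair (al be : R) (mus : list Cx) :
    Rabs be <= M -> paired M mus -> paired M (mkCx al be :: mkCx al (- be) :: mus)
| paired_perm (mus nus : list Cx) :
    Permutation mus nus -> paired M mus -> paired M nus.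

Lemma applyOps_conj (M : R) (mus : list Cx) (F : nat -> R -> Cx) :
  paired M mus -> applyOps mus (conj_tower F) = conj_tower (applyOps mus F).
Proof.
  induction 1; simpl.
  - reflexivity.
  - rewrite IHpaired; extensionality k; extensionality x; apply Cx_eq;
      unfold opD, conj_tower; simpl; ring.
  - rewrite IHpaired; extensionality k; extensionality x; apply Cx_eq;
      unfold opD, conj_tower; simpl; ring.
  - rewrite <- !(applyOps_perm mus nus) by assumption; exact IHpaired.
Qed.

(** Membership of the conjugate says nothing about multiplicities. Splitting off a real entry, or an
    entry with its conjugate, leaves a list that is again closed by [closed_conj_app], so the
    induction matches multiplicities by itself. *)
Lemma closed_conj_paired (M : R) (mus : list Cx) :
  0 <= M -> (forall l, In l mus -> Rabs (cim l) <= M) -> closed_conj mus -> paired M mus.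
Proof.
  intros HM; remember (length mus) as n eqn:Hn; revert mus Hn.
  induction n as [n IH] using lt_wf_ind; intros mus Hn Him Hcl.
  destruct mus as [| [al be] mus]; [constructor |].
  destruct (Req_dec be 0) as [-> | Hbe].
  - apply (paired_real M al), (IH (length mus)); try reflexivity.
    + subst; simpl; lia.
    + intros l Hl; apply Him; right; exact Hl.
    + apply (closed_conj_app [RtoC al]); [| exact Hcl].
      intros F; apply (applyOps_conj M); repeat constructor.
  - destruct (conj_mem _ (mkCx al be) Hcl (or_introl eq_refl)) as [E | Hin].
    { injection E as E; lra. }
    destruct (in_split _ _ Hin) as [m1 [m2 ->]].
    assert (P : Permutation (mkCx al be :: mkCx al (- be) :: m1 ++ m2)
                  (mkCx al be :: m1 ++ Cconj (mkCx al be) :: m2)).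
    { apply perm_skip, Permutation_middle. }
    assert (Hb : Rabs be <= M) by (apply (Him (mkCx al be)); left; reflexivity).
    apply (paired_perm M _ _ P), paired_pair; [exact Hb |].
    apply (IH (length (m1 ++ m2))); try reflexivity.
    + subst n; simpl; rewrite !length_app; simpl; lia.
    + intros l Hl; apply Him; right; apply in_or_app; simpl.
      apply in_app_or in Hl; tauto.
    + apply (closed_conj_app [mkCx al be; mkCx al (- be)]).
      * intros F; apply (applyOps_conj M); apply paired_pair; [exact Hb | constructor].
      * apply (closed_conj_perm _ _ (Permutation_sym P)), Hcl.
Qed.

(** * Chebyshev systems *)

Definition rtower (F : nat -> R -> R) : Prop :=
  forall k x, derivable_pt_lim (F k) x (F (S k) x).

Definition cplx (F : nat -> R -> R) : nat -> R -> Cx := fun k x => RtoC (F k x).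

Definition lincomb (c : R) (F : nat -> R -> R) (d : R) (G : nat -> R -> R) : nat -> R -> R :=
  fun k x => c * F k x + d * G k x.

Definition ropD (l : R) (F : nat -> R -> R) : nat -> R -> R :=
  fun k x => F (S k) x - l * F k x.

(** The real-valued part of E_mus. The whole tower is carried along, so that orders of vanishing at
    the endpoints are statements about its values. *)
Definition inV (mus : list Cx) (F : nat -> R -> R) : Prop :=
  rtower F /\ forall x, applyOps mus (cplx F) 0%nat x = C0.

Lemma rtower_lincomb (c d : R) (F G : nat -> R -> R) :
  rtower F -> rtower G -> rtower (lincomb c F d G).
Proof. intros HF HG k x; apply derivable_pt_lim_lincomb; [apply HF | apply HG]. Qed.

Lemma rtower_continuity (F : nat -> R -> R) (k : nat) (x : R) : rtower F -> continuity_pt (F k) x.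
Proof. intros HF; exact (derivable_pt_lim_continuity _ _ _ (HF k x)). Qed.

Lemma applyOps_lincomb (mus : list Cx) (c d : Cx) (F G : nat -> R -> Cx) (k : nat) (x : R) :
  applyOps mus (fun k x => Cadd (Cmul c (F k x)) (Cmul d (G k x))) k x
  = Cadd (Cmul c (applyOps mus F k x)) (Cmul d (applyOps mus G k x)).
Proof.
  revert k; induction mus as [| l mus IH]; intros k; [reflexivity |].
  change (opD l (applyOps mus (fun k x => Cadd (Cmul c (F k x)) (Cmul d (G k x)))) k x
          = Cadd (Cmul c (opD l (applyOps mus F) k x)) (Cmul d (opD l (applyOps mus G) k x))).
  unfold opD; rewrite !IH; ring.
Qed.

Lemma inV_lincomb (mus : list Cx) (c d : R) (F G : nat -> R -> R) :
  inV mus F -> inV mus G -> inV mus (lincomb c F d G).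
Proof.
  intros [HF HF0] [HG HG0]; split; [apply rtower_lincomb; assumption |].
  intros x.
  replace (cplx (lincomb c F d G))
    with (fun k x => Cadd (Cmul (RtoC c) (cplx F k x)) (Cmul (RtoC d) (cplx G k x))).
  - rewrite applyOps_lincomb, HF0, HG0; ring.
  - extensionality k; extensionality y; apply Cx_eq; simpl; unfold lincomb; ring.
Qed.

Lemma inV_perm (mus nus : list Cx) (F : nat -> R -> R) :
  Permutation mus nus -> inV mus F -> inV nus F.
Proof.
  intros P [HF H]; split; [exact HF |].
  intros x; rewrite <- (applyOps_perm _ _ _ P); apply H.
Qed.

Lemma rtower_ropD (l : R) (F : nat -> R -> R) : rtower F -> rtower (ropD l F).
Proof.
  intros HF k x; unfold ropD.
  apply (derivable_pt_lim_minus (F (S k)) (fun x => l * F k x)); [apply HF |].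
  apply (derivable_pt_lim_scal (F k)), HF.
Qed.

Lemma inV_ropD (l : R) (mus : list Cx) (F : nat -> R -> R) :
  inV (RtoC l :: mus) F -> inV mus (ropD l F).
Proof.
  intros [HF H]; split; [apply rtower_ropD, HF |].
  intros x; specialize (H x); rewrite applyOps_cons_inner in H.
  replace (cplx (ropD l F)) with (opD (RtoC l) (cplx F)); [exact H |].
  extensionality k; extensionality y; apply Cx_eq; unfold opD, ropD; simpl; ring.
Qed.

(** Real and imaginary parts are combinations of F and its conjugate, and the operator of a paired
    list commutes with conjugation. *)
Lemma inV_cre_cim (M : R) (mus : list Cx) (F : nat -> R -> Cx) :
  paired M mus -> deriv_tower F -> (forall x, applyOps mus F 0%nat x = C0) ->
  inV mus (fun k x => cre (F k x)) /\ inV mus (fun k x => cim (F k x)).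
Proof.
  intros HM HF HF0.
  assert (Hc : forall x, applyOps mus (conj_tower F) 0%nat x = C0).
  { intros x; rewrite (applyOps_conj M) by exact HM; unfold conj_tower; rewrite HF0.
    apply Cx_eq; simpl; ring. }
  split; split; try (intros k x; apply (HF k x)); intros x.
  - replace (cplx (fun k x => cre (F k x))) with
      (fun k x => Cadd (Cmul (RtoC (/ 2)) (F k x)) (Cmul (RtoC (/ 2)) (conj_tower F k x))).
    + rewrite applyOps_lincomb, HF0, Hc; ring.
    + extensionality k; extensionality y; apply Cx_eq; simpl; field.
  - replace (cplx (fun k x => cim (F k x))) with
      (fun k x => Cadd (Cmul (mkCx 0 (- / 2)) (F k x)) (Cmul (mkCx 0 (/ 2)) (conj_tower F k x))).
    + rewrite applyOps_lincomb, HF0, Hc; ring.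
    + extensionality k; extensionality y; apply Cx_eq; simpl; field.
Qed.

(** * Zeros on an interval and counting by Rolle's theorem *)

Lemma derivable_pt_lim_zero_interval (a b : R) (f : R -> R) (x l : R) :
  a < b -> a <= x <= b -> (forall y, a <= y <= b -> f y = 0) ->
  derivable_pt_lim f x l -> l = 0.
Proof.
  intros Hab Hx Hf Hd.
  destruct (Req_dec l 0) as [E | Hl]; [exact E | exfalso].
  destruct (Hd (Rabs l) (Rabs_pos_lt _ Hl)) as [del Hdel].
  assert (Hpos := cond_pos del).
  (* The increment points into [a,b], where f vanishes, so the derivative is forced to be 0 at the
     endpoints as well. *)
  assert (Hh : exists h, h <> 0 /\ Rabs h < del /\ a <= x + h <= b).
  { destruct (Rlt_or_le x b) as [Hxb | Hxb].
    - exists (Rmin (del / 2) (b - x)).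
      assert (H1 := Rmin_l (del / 2) (b - x)); assert (H2 := Rmin_r (del / 2) (b - x)).
      assert (H3 : 0 < Rmin (del / 2) (b - x)) by (apply Rmin_glb_lt; lra).
      rewrite Rabs_pos_eq by lra; repeat split; lra.
    - exists (- Rmin (del / 2) (x - a)).
      assert (H1 := Rmin_l (del / 2) (x - a)); assert (H2 := Rmin_r (del / 2) (x - a)).
      assert (H3 : 0 < Rmin (del / 2) (x - a)) by (apply Rmin_glb_lt; lra).
      rewrite Rabs_Ropp, Rabs_pos_eq by lra; repeat split; lra. }
  destruct Hh as [h [H1 [H2 H3]]]; specialize (Hdel h H1 H2).
  rewrite !Hf in Hdel by lra.
  replace ((0 - 0) / h - l) with (- l) in Hdel by (field; exact H1).
  rewrite Rabs_Ropp in Hdel; lra.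
Qed.

Lemma rtower_zero_interval (a b : R) (F : nat -> R -> R) :
  a < b -> rtower F -> (forall x, a <= x <= b -> F 0%nat x = 0) ->
  forall k x, a <= x <= b -> F k x = 0.
Proof.
  intros Hab HF H0 k; induction k as [| k IH]; [exact H0 |].
  intros x Hx; apply (derivable_pt_lim_zero_interval a b (F k) x); auto.
Qed.

(** Encodes finitely many distinct points of an open interval; the left end is an argument because
    inductions on the list move it. *)
Fixpoint incr (x : R) (l : list R) (y : R) : Prop :=
  match l with
  | [] => x < y
  | z :: l' => x < z /\ incr z l' y
  end.

Lemma incr_lt (x y : R) (l : list R) : incr x l y -> x < y.
Proof.
  revert x; induction l as [| z l IH]; simpl; intros x H; [exact H |].
  destruct H as [H1 H2]; specialize (IH z H2); lra.
Qed.

Lemma incr_weaken (x x' y : R) (l : list R) : x' <= x -> incr x l y -> incr x' l y.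
Proof. destruct l; simpl; intros H; [lra | intros [H1 H2]; split; [lra | exact H2]]. Qed.

Lemma incr_bounds (x y z : R) (l : list R) : incr x l y -> In z l -> x < z < y.
Proof.
  revert x; induction l as [| w l IH]; simpl; intros x H Hz; [contradiction |].
  destruct H as [H1 H2], Hz as [-> | Hz].
  - apply incr_lt in H2; lra.
  - specialize (IH w H2 Hz); lra.
Qed.

(** Rolle's conclusion taken as a relation, so that the counting is the same for every first-order
    factor that turns f into g. *)
Definition interlaces (a b : R) (f g : R -> R) : Prop :=
  forall x y, a <= x -> x < y -> y <= b -> f x = 0 -> f y = 0 ->
    exists z, x < z < y /\ g z = 0.

Lemma interlaces_derive (a b : R) (f g f' : R -> R) (w v : R -> R) :
  (forall x, a <= x <= b -> derivable_pt_lim (fun y => w y * f y) x (f' x)) ->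
  (forall x, a <= x <= b -> f' x = v x * g x) ->
  (forall x, a <= x <= b -> v x <> 0) ->
  interlaces a b f g.
Proof.
  intros Hd Hf' Hv x y Hx Hxy Hy Hfx Hfy.
  destruct (MVT_cor2 (fun y => w y * f y) f' x y Hxy) as [z [Hz Hz']].
  { intros c Hc; apply Hd; lra. }
  exists z; split; [exact Hz' |].
  rewrite Hfx, Hfy, !Rmult_0_r, Hf' in Hz by lra.
  assert (Hp : v z * g z = 0).
  { apply (Rmult_eq_reg_r (y - x)); [| lra]; rewrite <- Hz; ring. }
  destruct (Rmult_integral _ _ Hp) as [E | E]; [| exact E].
  destruct (Hv z); [lra | exact E].
Qed.

Lemma interlaces_list_left (a b : R) (f g : R -> R) (y : R) (l : list R) :
  interlaces a b f g -> y <= b ->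
  forall x, a <= x -> f x = 0 -> incr x l y -> (forall z, In z l -> f z = 0) ->
  exists l', incr x l' y /\ (forall z, In z l' -> g z = 0) /\ length l' = length l.
Proof.
  intros Hi Hy; induction l as [| z l IH]; simpl; intros x Hx Hfx Hl Hz.
  - exists []; repeat split; simpl; [exact Hl | contradiction].
  - destruct Hl as [Hxz Hl].
    destruct (IH z) as [l' [H1 [H2 H3]]]; try (auto; lra).
    assert (Hzy := incr_lt _ _ _ Hl).
    destruct (Hi x z) as [w [Hw Hgw]]; try (auto; lra).
    exists (w :: l'); repeat split; simpl.
    + lra.
    + apply (incr_weaken z); [lra | exact H1].
    + intros u [<- | Hu]; auto.
    + congruence.
Qed.

Lemma interlaces_list_both (a b : R) (f g : R -> R) (y : R) (l : list R) :
  interlaces a b f g -> y <= b -> f y = 0 ->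
  forall x, a <= x -> f x = 0 -> incr x l y -> (forall z, In z l -> f z = 0) ->
  exists l', incr x l' y /\ (forall z, In z l' -> g z = 0) /\ length l' = S (length l).
Proof.
  intros Hi Hy Hfy; induction l as [| z l IH]; simpl; intros x Hx Hfx Hl Hz.
  - destruct (Hi x y) as [w [Hw Hgw]]; try (auto; lra).
    exists [w]; repeat split; simpl; try lra.
    intros u [<- | []]; exact Hgw.
  - destruct Hl as [Hxz Hl].
    destruct (IH z) as [l' [H1 [H2 H3]]]; try (auto; lra).
    assert (Hzy := incr_lt _ _ _ Hl).
    destruct (Hi x z) as [w [Hw Hgw]]; try (auto; lra).
    exists (w :: l'); repeat split; simpl.
    + lra.
    + apply (incr_weaken z); [lra | exact H1].
    + intros u [<- | Hu]; auto.
    + congruence.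
Qed.

(** A positive order [na] or [nb] adds one endpoint to the distinct zeros of f, and g has a zero in
    every gap between neighbours. The loss of one is written as [S] on the right to avoid truncated
    subtraction. *)
Lemma interlaces_count (a b : R) (f g : R -> R) (na nb : nat) (l : list R) :
  interlaces a b f g -> incr a l b -> (forall z, In z l -> f z = 0) ->
  ((0 < na)%nat -> f a = 0) -> ((0 < nb)%nat -> f b = 0) ->
  exists l', incr a l' b /\ (forall z, In z l' -> g z = 0) /\
    (Nat.min 1 na + length l + Nat.min 1 nb <= S (length l'))%nat.
Proof.
  intros Hi Hl Hz Ha Hb.
  assert (Hab := incr_lt _ _ _ Hl).
  destruct na as [| na], nb as [| nb].
  - destruct l as [| z l]; simpl in *.
    + exists []; repeat split; simpl; [exact Hab | contradiction | lia].
    + destruct Hl as [Hl1 Hl2].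
      destruct (interlaces_list_left a b f g b l Hi (Rle_refl _) z) as [l' [H1 [H2 H3]]];
        try (auto; lra).
      exists l'; split; [apply (incr_weaken z); [lra | exact H1] | split; [exact H2 | lia]].
  - destruct l as [| z l]; simpl in *.
    + exists []; repeat split; simpl; [exact Hab | contradiction | lia].
    + destruct Hl as [Hl1 Hl2].
      destruct (interlaces_list_both a b f g b l Hi (Rle_refl _)) with (x := z)
        as [l' [H1 [H2 H3]]]; try (auto; lra).
      { apply Hb; lia. }
      exists l'; split; [apply (incr_weaken z); [lra | exact H1] | split; [exact H2 | lia]].
  - destruct (interlaces_list_left a b f g b l Hi (Rle_refl _) a) as [l' [H1 [H2 H3]]];
      try (auto; lra).
    { apply Ha; lia. }
    exists l'; split; [exact H1 | split; [exact H2 | simpl; lia]].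
  - destruct (interlaces_list_both a b f g b l Hi (Rle_refl _)) with (x := a)
      as [l' [H1 [H2 H3]]]; try (auto; lra).
    { apply Hb; lia. }
    { apply Ha; lia. }
    exists l'; split; [exact H1 | split; [exact H2 | simpl; lia]].
Qed.

(** The product w f is constant, and a single zero of f makes the constant 0. *)
Lemma zero_from_derive (a b : R) (w f f' : R -> R) (x0 : R) :
  (forall x, a <= x <= b -> derivable_pt_lim (fun y => w y * f y) x (f' x)) ->
  (forall x, a <= x <= b -> f' x = 0) ->
  (forall x, a <= x <= b -> w x <> 0) ->
  a <= x0 <= b -> f x0 = 0 ->
  forall x, a <= x <= b -> f x = 0.
Proof.
  intros Hd Hf' Hw Hx0 Hfx0 x Hx.
  assert (E : w x * f x = 0).
  { destruct (Rtotal_order x x0) as [H | [-> | H]]; [| rewrite Hfx0; ring |].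
    - destruct (MVT_cor2 (fun y => w y * f y) f' x x0 H) as [z [Hz Hz']].
      { intros c Hc; apply Hd; lra. }
      rewrite Hf', Hfx0 in Hz by lra; lra.
    - destruct (MVT_cor2 (fun y => w y * f y) f' x0 x H) as [z [Hz Hz']].
      { intros c Hc; apply Hd; lra. }
      rewrite Hf', Hfx0 in Hz by lra; lra. }
  destruct (Rmult_integral _ _ E) as [E' | E']; [destruct (Hw x Hx E') | exact E'].
Qed.

Lemma zero_exists (a b : R) (f : R -> R) (na nb : nat) (l : list R) :
  incr a l b -> (forall z, In z l -> f z = 0) ->
  ((0 < na)%nat -> f a = 0) -> ((0 < nb)%nat -> f b = 0) ->
  (1 <= na + nb + length l)%nat ->
  exists x, a <= x <= b /\ f x = 0.
Proof.
  intros Hl Hz Ha Hb Hn; assert (Hab := incr_lt _ _ _ Hl).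
  destruct na as [| na]; [| exists a; split; [lra | apply Ha; lia]].
  destruct nb as [| nb]; [| exists b; split; [lra | apply Hb; lia]].
  destruct l as [| z l]; [simpl in Hn; lia |].
  exists z; split; [| apply Hz; left; reflexivity].
  assert (H := incr_bounds a b z (z :: l) Hl (or_introl eq_refl)); lra.
Qed.

(* For a conjugate pair al +- i be, with c the midpoint, (D - al)^2 + be^2 factors on [a,b]
   through the positive solution e^{al x} cos (be (x - c)). *)
Lemma cos_midpoint_pos (a b M be x : R) :
  0 < M -> M * (b - a) < PI -> Rabs be <= M -> a <= x <= b ->
  0 < cos (be * (x - (a + b) / 2)).
Proof.
  intros HM Hab Hbe Hx.
  assert (H : Rabs (be * (x - (a + b) / 2)) <= M * ((b - a) / 2)).
  { rewrite Rabs_mult; apply Rmult_le_compat; try apply Rabs_pos; [exact Hbe |].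
    apply Rabs_le; lra. }
  apply Rabs_le_between in H; apply cos_gt_0; lra.
Qed.

(** Zeros are counted with multiplicity at the endpoints and as distinct points inside. Each
    first-order factor costs one in total: a positive endpoint order drops by one, but the endpoint
    is then an extra point for Rolle. Once the reduced function vanishes, F is a constant multiple
    of a zero-free function, and it has a zero. *)
Lemma chebyshev (a b M : R) (mus : list Cx) :
  0 < M -> M * (b - a) < PI -> paired M mus ->
  forall F ka kb l, inV mus F ->
    (forall j, (j < ka)%nat -> F j a = 0) -> (forall j, (j < kb)%nat -> F j b = 0) ->
    incr a l b -> (forall z, In z l -> F 0%nat z = 0) ->
    (length mus <= ka + kb + length l)%nat ->
    forall x, a <= x <= b -> F 0%nat x = 0.
Proof.
  intros HM Hab Hp; induction Hp as [| lam mus Hp IH | al be mus Hbe Hp IH | mus nus P Hp IH];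
    intros F ka kb l HV Ha Hb Hl Hz Hn x Hx.
  - destruct HV as [_ HV]; specialize (HV x); simpl in HV; injection HV; auto.
  - assert (HF := proj1 HV).
    assert (HG := inV_ropD _ _ _ HV).
    assert (Hd : forall x, derivable_pt_lim (fun y => exp (- lam * y) * F 0%nat y) x
                   (exp (- lam * x) * ropD lam F 0%nat x)).
    { intros y; eapply derivable_pt_lim_value.
      - apply (derivable_pt_lim_mult (fun y => exp (- lam * y)) (F 0%nat)); [| apply HF].
        apply is_derive_Reals; auto_derive; [auto | reflexivity].
      - unfold ropD; ring. }
    assert (He : forall y, exp (- lam * y) <> 0)
      by (intros y; apply Rgt_not_eq, exp_pos).
    destruct (interlaces_count a b (F 0%nat) (ropD lam F 0%nat) ka kb l)
      as [l' [Hl' [Hz' Hn']]]; auto.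
    { apply (interlaces_derive a b _ _ _ (fun y => exp (- lam * y)) (fun y => exp (- lam * y))
        (fun y _ => Hd y)); auto. }
    assert (HG0 : forall y, a <= y <= b -> ropD lam F 0%nat y = 0).
    { apply (IH (ropD lam F) (ka - 1)%nat (kb - 1)%nat l'); auto.
      - intros j Hj; unfold ropD; rewrite !Ha by lia; ring.
      - intros j Hj; unfold ropD; rewrite !Hb by lia; ring.
      - simpl in Hn; lia. }
    destruct (zero_exists a b (F 0%nat) ka kb l) as [x0 [Hx0 Hfx0]]; auto.
    { simpl in Hn; lia. }
    apply (zero_from_derive a b (fun y => exp (- lam * y)) (F 0%nat) _ x0 (fun y _ => Hd y));
      auto.
    intros y Hy; rewrite HG0 by exact Hy; ring.
  - assert (HF := proj1 HV).
    set (G := fun k x => F (S (S k)) x - 2 * al * F (S k) x + (al * al + be * be) * F k x).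
    assert (HG : inV mus G).
    { split.
      - intros k y; unfold G.
        apply (derivable_pt_lim_plus (fun y => F (S (S k)) y - 2 * al * F (S k) y)
          (fun y => (al * al + be * be) * F k y)); [| apply (derivable_pt_lim_scal (F k)), HF].
        apply (derivable_pt_lim_minus (F (S (S k))) (fun y => 2 * al * F (S k) y)); [apply HF |].
        apply (derivable_pt_lim_scal (F (S k))), HF.
      - intros y; destruct HV as [_ HV]; specialize (HV y).
        rewrite !applyOps_cons_inner in HV.
        replace (cplx G) with (opD (mkCx al (- be)) (opD (mkCx al be) (cplx F))); [exact HV |].
        extensionality k; extensionality z; apply Cx_eq; unfold opD, G; simpl; ring. }
    set (c := fun y => cos (be * (y - (a + b) / 2))).
    set (s := fun y => sin (be * (y - (a + b) / 2))).
    assert (Hc : forall y, a <= y <= b -> 0 < c y).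
    { intros y Hy; apply (cos_midpoint_pos a b M); assumption. }
    (* Up to the factor e^{al y}, the Wronskian of the positive solution and F: the output of the
       first factor and the input of the second. It involves only F and F', so it still vanishes at
       an endpoint where F has order at least 2. *)
    set (g := fun y => (F 1%nat y - al * F 0%nat y) * c y + be * F 0%nat y * s y).
    assert (He : forall y, exp (- al * y) <> 0)
      by (intros y; apply Rgt_not_eq, exp_pos).
    assert (Hdc : forall y, derivable_pt_lim c y (- be * s y)).
    { intros y; apply is_derive_Reals; unfold c, s; auto_derive; [auto | unfold Rminus; ring]. }
    assert (Hds : forall y, derivable_pt_lim s y (be * c y)).
    { intros y; apply is_derive_Reals; unfold c, s; auto_derive; [auto | unfold Rminus; ring]. }
    assert (Hde : forall y, derivable_pt_lim (fun y => exp (- al * y)) y (- al * exp (- al * y))).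
    { intros y; apply is_derive_Reals; auto_derive; [auto | ring]. }
    assert (Hd1 : forall y, a <= y <= b ->
      derivable_pt_lim (fun y => exp (- al * y) / c y * F 0%nat y) y
        (exp (- al * y) / (c y * c y) * g y)).
    { intros y Hy; specialize (Hc y Hy); eapply derivable_pt_lim_value.
      - apply (derivable_pt_lim_mult (fun y => exp (- al * y) / c y) (F 0%nat)); [| apply HF].
        apply (derivable_pt_lim_div (fun y => exp (- al * y)) c); [apply Hde | apply Hdc | lra].
      - unfold g, Rsqr; field; lra. }
    assert (Hd2 : forall y, derivable_pt_lim (fun y => exp (- al * y) * g y) y
        (exp (- al * y) * c y * G 0%nat y)).
    { intros y; eapply derivable_pt_lim_value.
      - apply (derivable_pt_lim_mult (fun y => exp (- al * y)) g); [apply Hde |].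
        apply (derivable_pt_lim_plus (fun y => (F 1%nat y - al * F 0%nat y) * c y)
          (fun y => be * F 0%nat y * s y)).
        + apply (derivable_pt_lim_mult (fun y => F 1%nat y - al * F 0%nat y) c); [| apply Hdc].
          apply (rtower_ropD al F HF).
        + apply (derivable_pt_lim_mult (fun y => be * F 0%nat y) s); [| apply Hds].
          apply (derivable_pt_lim_scal (F 0%nat)), HF.
      - unfold g, G, ropD; ring. }
    destruct (interlaces_count a b (F 0%nat) g ka kb l) as [l' [Hl' [Hz' Hn']]]; auto.
    { apply (interlaces_derive a b _ _ _ (fun y => exp (- al * y) / c y)
        (fun y => exp (- al * y) / (c y * c y)) Hd1); auto.
      intros y Hy; specialize (Hc y Hy); assert (Hey := exp_pos (- al * y)).
      apply Rgt_not_eq, Rdiv_lt_0_compat; nra. }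
    assert (Hga : (0 < ka - 1)%nat -> g a = 0).
    { intros Hk; unfold g; rewrite !Ha by lia; ring. }
    assert (Hgb : (0 < kb - 1)%nat -> g b = 0).
    { intros Hk; unfold g; rewrite !Hb by lia; ring. }
    destruct (interlaces_count a b g (G 0%nat) (ka - 1) (kb - 1) l')
      as [l'' [Hl'' [Hz'' Hn'']]]; auto.
    { apply (interlaces_derive a b _ _ _ (fun y => exp (- al * y))
        (fun y => exp (- al * y) * c y) (fun y _ => Hd2 y)); auto.
      intros y Hy; specialize (Hc y Hy); apply Rmult_integral_contrapositive_currified;
        [apply He | lra]. }
    assert (HG0 : forall y, a <= y <= b -> G 0%nat y = 0).
    { apply (IH G (ka - 2)%nat (kb - 2)%nat l''); auto.
      - intros j Hj; unfold G; rewrite !Ha by lia; ring.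
      - intros j Hj; unfold G; rewrite !Hb by lia; ring.
      - simpl in Hn; lia. }
    simpl in Hn.
    destruct (zero_exists a b g (ka - 1) (kb - 1) l') as [x1 [Hx1 Hgx1]]; auto; [lia |].
    assert (Hg0 : forall y, a <= y <= b -> g y = 0).
    { apply (zero_from_derive a b (fun y => exp (- al * y)) g _ x1 (fun y _ => Hd2 y)); auto.
      intros y Hy; rewrite HG0 by exact Hy; ring. }
    destruct (zero_exists a b (F 0%nat) ka kb l) as [x0 [Hx0 Hfx0]]; auto; [lia |].
    apply (zero_from_derive a b (fun y => exp (- al * y) / c y) (F 0%nat) _ x0 Hd1); auto.
    + intros y Hy; rewrite Hg0 by exact Hy; ring.
    + intros y Hy; specialize (Hc y Hy); apply Rgt_not_eq, Rdiv_lt_0_compat;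
        [apply exp_pos | exact Hc].
  - apply (IH F ka kb l); auto.
    + apply (inV_perm nus mus), HV; apply Permutation_sym, P.
    + rewrite (Permutation_length P); exact Hn.
Qed.

(** * Bernstein bases *)

Definition admissible (a b M : R) (mus : list Cx) : Prop :=
  a < b /\ 0 < M /\ M * (b - a) < PI /\ paired M mus.

Lemma admissible_cons (a b M l : R) (mus : list Cx) :
  admissible a b M mus -> admissible a b M (RtoC l :: mus).
Proof. intros [H1 [H2 [H3 H4]]]; repeat split; auto; apply paired_real, H4. Qed.

(** The form in which the Chebyshev property is mostly applied: two functions of the space agree on
    [a,b], with all derivatives, once their leading terms at a and b match. *)
Lemma zero_of_endpoint_orders (a b M : R) (mus : list Cx) (F : nat -> R -> R) (ka kb : nat) :
  admissible a b M mus -> inV mus F ->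
  (forall j, (j < ka)%nat -> F j a = 0) -> (forall j, (j < kb)%nat -> F j b = 0) ->
  (length mus <= ka + kb)%nat ->
  forall k x, a <= x <= b -> F k x = 0.
Proof.
  intros [Hab [HM [HMab Hp]]] HV Ha Hb Hn.
  apply rtower_zero_interval; [exact Hab | exact (proj1 HV) |].
  apply (chebyshev a b M mus HM HMab Hp F ka kb []); auto; simpl; [contradiction | lia].
Qed.

Definition isB (a b : R) (mus : list Cx) (k : nat) (P : nat -> R -> R) : Prop :=
  inV mus P /\ (forall j, (j < k)%nat -> P j a = 0) /\ P k a = 1 /\
  (forall j, (j < length mus - 1 - k)%nat -> P j b = 0).

(** One further zero at b would raise the endpoint orders to the dimension of the space; P and its
    derivatives would vanish on [a,b], against P^(k)(a) = 1. *)
Lemma isB_exact_order (a b M : R) (mus : list Cx) (k : nat) (P : nat -> R -> R) :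
  admissible a b M mus -> (k < length mus)%nat -> isB a b mus k P ->
  P (length mus - 1 - k)%nat b <> 0.
Proof.
  intros Had Hk [HV [Ha [Hka Hb]]] E; assert (Hab := proj1 Had).
  enough (P k a = 0) by lra.
  apply (zero_of_endpoint_orders a b M mus P k (S (length mus - 1 - k))); auto; [| lia | lra].
  intros j Hj; destruct (Nat.eq_dec j (length mus - 1 - k)) as [-> | Hne]; [exact E |].
  apply Hb; lia.
Qed.

(* Gaussian elimination at b: the elements of index m, m-1, ..., k+1 have order exactly
   0, 1, ..., m-k-1 there. *)
Lemma isB_exists (a b M : R) (mus : list Cx) (k : nat) :
  admissible a b M mus -> (k < length mus)%nat -> exists P, isB a b mus k P.
Proof.
  intros Had Hk; remember (length mus - k)%nat as i eqn:Hi; revert k Hk Hi.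
  induction i as [i IH] using lt_wf_ind; intros k Hk Hi.
  enough (H : forall r, (r <= length mus - 1 - k)%nat -> exists P, inV mus P /\
     (forall j, (j < k)%nat -> P j a = 0) /\ P k a = 1 /\
     (forall j, (j < r)%nat -> P j b = 0)).
  { destruct (H (length mus - 1 - k)%nat (le_n _)) as [P HP]; exists P; exact HP. }
  intros r; induction r as [| r IHr]; intros Hr.
  - destruct (initial_value_problem a mus (fun j => if Nat.eq_dec j k then C1 else C0))
      as [F [HF [HF0 HFa]]].
    exists (fun j x => cre (F j x)).
    split; [apply (inV_cre_cim M); auto; apply Had | split; [| split]].
    + intros j Hj; rewrite HFa by lia; destruct (Nat.eq_dec j k); [lia | reflexivity].
    + rewrite HFa by lia; destruct (Nat.eq_dec k k); [reflexivity | lia].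
    + intros; lia.
  - destruct IHr as [F [HF [HFa [HFk HFb]]]]; [lia |].
    destruct (IH (S r)) with (k := (length mus - 1 - r)%nat) as [P HP]; try lia.
    assert (Hex := isB_exact_order a b M mus (length mus - 1 - r) P Had ltac:(lia) HP).
    destruct HP as [HP [HPa [_ HPb]]].
    replace (length mus - 1 - (length mus - 1 - r))%nat with r in Hex, HPb by lia.
    exists (lincomb 1 F (- (F r b / P r b)) P).
    split; [apply inV_lincomb; assumption | unfold lincomb; split; [| split]].
    + intros j Hj; rewrite HFa, HPa by lia; ring.
    + rewrite HFk, HPa by lia; ring.
    + intros j Hj; destruct (Nat.eq_dec j r) as [-> | Hne]; [field; exact Hex |].
      rewrite (HFb j), (HPb j) by lia; ring.
Qed.

(** * Taylor estimates at the endpoints and signs of the basis elements *)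

Lemma deriv_nonneg_le (f f' : R -> R) (c d : R) :
  (forall x, c <= x <= d -> derivable_pt_lim f x (f' x)) ->
  (forall x, c <= x <= d -> 0 <= f' x) -> c <= d -> f c <= f d.
Proof.
  intros Hd Hp [Hcd | ->]; [| lra].
  destruct (MVT_cor2 f f' c d Hcd Hd) as [z [Hz Hz']].
  assert (H : 0 <= f' z) by (apply Hp; lra); nra.
Qed.

(** A lower bound for the r-th derivative is integrated r times: the difference of the two sides has
    nonnegative derivative by the case r - 1 for the shifted tower. *)
Lemma taylor_lower (F : nat -> R -> R) (c d lo : R) (r : nat) :
  rtower F -> (forall j, (j < r)%nat -> F j c = 0) ->
  (forall x, c <= x <= d -> lo <= F r x) ->
  forall x, c <= x <= d -> lo * ((x - c) ^ r / INR (fact r)) <= F 0%nat x.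
Proof.
  revert F; induction r as [| r IH]; intros F HF Hc Hlo x Hx.
  - simpl; specialize (Hlo x Hx); lra.
  - assert (HS : forall y, c <= y <= d -> lo * ((y - c) ^ r / INR (fact r)) <= F 1%nat y).
    { apply (IH (fun k => F (S k))); auto.
      - intros k y; apply HF.
      - intros j Hj; apply Hc; lia. }
    assert (Hf : INR (fact r) <> 0) by apply INR_fact_neq_0.
    assert (Hr : INR (S r) <> 0) by (apply not_0_INR; lia).
    assert (H := deriv_nonneg_le
      (fun y => F 0%nat y - lo * ((y - c) ^ S r / INR (fact (S r))))
      (fun y => F 1%nat y - lo * ((y - c) ^ r / INR (fact r))) c x).
    cbv beta in H; rewrite Hc, Rminus_diag, pow_i in H by lia.
    enough (0 - lo * (0 / INR (fact (S r))) <= F 0%nat x - lo * ((x - c) ^ S r / INR (fact (S r))))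
      by (unfold Rdiv in *; lra).
    apply H; [| | lra].
    + intros y Hy.
      apply (derivable_pt_lim_minus (F 0%nat) (fun y => lo * ((y - c) ^ S r / INR (fact (S r)))));
        [apply HF |].
      apply (derivable_pt_lim_scal (fun y => (y - c) ^ S r / INR (fact (S r)))).
      rewrite fact_simpl, mult_INR; apply is_derive_Reals; auto_derive; [auto |].
      change (Nat.pred (S r)) with r; unfold Rminus; field; split; assumption.
    + intros y Hy; specialize (HS y ltac:(lra)); lra.
Qed.

Lemma taylor_limit_right (F : nat -> R -> R) (c : R) (r : nat) :
  rtower F -> (forall j, (j < r)%nat -> F j c = 0) ->
  forall eps, 0 < eps -> exists d, 0 < d /\ forall x, c < x < c + d ->
    Rabs (F 0%nat x / ((x - c) ^ r / INR (fact r)) - F r c) < eps.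
Proof.
  intros HF Hc eps Heps.
  destruct (rtower_continuity F r c HF (eps / 2)) as [d [Hd Hcont]]; [lra |].
  simpl in Hcont; unfold Rdist, D_x, no_cond in Hcont.
  assert (Hb : forall x, c <= x <= c + d / 2 -> Rabs (F r x - F r c) <= eps / 2).
  { intros x Hx; destruct (Req_dec x c) as [-> | Hne].
    - rewrite Rminus_diag, Rabs_R0; lra.
    - apply Rlt_le, Hcont; repeat split; auto; apply Rabs_def1; lra. }
  exists (d / 2); split; [lra |]; intros x Hx.
  assert (H1 := taylor_lower F c (c + d / 2) (F r c - eps / 2) r HF Hc).
  (* [lincomb (-1) F 0 F] is the tower of -F; its lower bound is the upper bound for F. *)
  assert (H2 := taylor_lower (lincomb (-1) F 0 F) c (c + d / 2) (- F r c - eps / 2) r).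
  set (q := (x - c) ^ r / INR (fact r)) in *.
  assert (Hq : 0 < q).
  { apply Rdiv_lt_0_compat; [apply pow_lt; lra | apply INR_fact_lt_0]. }
  assert (L1 : (F r c - eps / 2) * q <= F 0%nat x).
  { apply H1; [| lra]; intros y Hy; specialize (Hb y Hy).
    apply Rabs_le_between in Hb; lra. }
  assert (L2 : (- F r c - eps / 2) * q <= - F 0%nat x).
  { replace (- F 0%nat x) with (lincomb (-1) F 0 F 0%nat x) by (unfold lincomb; ring).
    apply H2; [apply rtower_lincomb; assumption | | | lra].
    - intros j Hj; unfold lincomb; rewrite Hc by exact Hj; ring.
    - intros y Hy; specialize (Hb y Hy); apply Rabs_le_between in Hb; unfold lincomb; lra. }
  assert (E : F 0%nat x = F 0%nat x / q * q) by (field; lra).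
  apply Rle_lt_trans with (eps / 2); [| lra]; apply Rabs_le; split.
  - apply (Rmult_le_reg_r q); [exact Hq |]; nra.
  - apply (Rmult_le_reg_r q); [exact Hq |]; nra.
Qed.

Lemma rtower_reflect (F : nat -> R -> R) :
  rtower F -> rtower (fun k x => (-1) ^ k * F k (- x)).
Proof.
  intros HF k x.
  eapply derivable_pt_lim_value.
  - apply (derivable_pt_lim_scal (fun x => F k (- x))).
    apply (derivable_pt_lim_comp (fun x => - x) (F k)); [| apply HF].
    apply (derivable_pt_lim_opp id), derivable_pt_lim_id.
  - simpl; ring.
Qed.

(** Reflection x -> -x reduces this to the right-hand case and produces the sign (-1)^r. *)
Lemma taylor_limit_left (F : nat -> R -> R) (b : R) (r : nat) :
  rtower F -> (forall j, (j < r)%nat -> F j b = 0) ->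
  forall eps, 0 < eps -> exists d, 0 < d /\ forall x, b - d < x < b ->
    Rabs (F 0%nat x / ((b - x) ^ r / INR (fact r)) - (-1) ^ r * F r b) < eps.
Proof.
  intros HF Hb eps Heps.
  destruct (taylor_limit_right _ (- b) r (rtower_reflect F HF)) with (eps := eps)
    as [d [Hd H]]; auto.
  { intros j Hj; rewrite Ropp_involutive, Hb by exact Hj; ring. }
  exists d; split; [exact Hd |]; intros x Hx.
  specialize (H (- x) ltac:(lra)); simpl in H; rewrite !Ropp_involutive, Rmult_1_l in H.
  replace (- x - - b) with (b - x) in H by ring; exact H.
Qed.

(** An interior zero would be one too many besides the k zeros at a and m - k at b, so the sign is
    constant inside, and near a it is that of (x - a)^k. *)
Lemma isB_pos (a b M : R) (mus : list Cx) (k : nat) (P : nat -> R -> R) :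
  admissible a b M mus -> (k < length mus)%nat -> isB a b mus k P ->
  forall x, a < x < b -> 0 < P 0%nat x.
Proof.
  intros [Hab [HM [HMab Hp]]] Hk [HV [Ha [Hka Hb]]] x Hx; assert (HP := proj1 HV).
  assert (Hnz : forall y, a < y < b -> P 0%nat y <> 0).
  { intros y Hy E; enough (P k a = 0) by lra.
    apply (rtower_zero_interval a b P Hab HP); [| lra].
    apply (chebyshev a b M mus HM HMab Hp P k (length mus - 1 - k) [y]); try assumption; simpl.
    - intros z [<- | []]; exact E.
    - lia. }
  destruct (taylor_limit_right P a k HP Ha (/ 2)) as [d [Hd H]]; [lra |].
  set (y := Rmin (a + d / 2) x).
  assert (Hy1 := Rmin_l (a + d / 2) x); assert (Hy2 := Rmin_r (a + d / 2) x).
  assert (Hy3 : a < y) by (apply Rmin_glb_lt; lra); fold y in Hy1, Hy2.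
  assert (Hy : 0 < P 0%nat y).
  { specialize (H y ltac:(lra)); rewrite Hka in H.
    assert (Hq : 0 < (y - a) ^ k / INR (fact k))
      by (apply Rdiv_lt_0_compat; [apply pow_lt; lra | apply INR_fact_lt_0]).
    apply Rabs_def2 in H.
    replace (P 0%nat y) with (P 0%nat y / ((y - a) ^ k / INR (fact k))
      * ((y - a) ^ k / INR (fact k))) by (field; split; [apply INR_fact_neq_0 | apply pow_nonzero; lra]).
    apply Rmult_lt_0_compat; lra. }
  destruct (Rlt_or_le 0 (P 0%nat x)) as [Hpos | Hneg]; [exact Hpos | exfalso].
  destruct (IVT_cor (P 0%nat) y x) as [z [Hz Ez]].
  - intros z; apply rtower_continuity, HP.
  - exact Hy2.
  - nra.
  - apply (Hnz z); [lra | exact Ez].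
Qed.

Lemma isB_sign_right (a b M : R) (mus : list Cx) (k : nat) (P : nat -> R -> R) :
  admissible a b M mus -> (k < length mus)%nat -> isB a b mus k P ->
  0 < (-1) ^ (length mus - 1 - k) * P (length mus - 1 - k)%nat b.
Proof.
  intros Had Hk HP; assert (Hpos := isB_pos _ _ _ _ _ _ Had Hk HP).
  assert (Hex := isB_exact_order _ _ _ _ _ _ Had Hk HP).
  destruct HP as [HV [_ [_ Hb]]]; set (r := (length mus - 1 - k)%nat) in *.
  assert (Hab := proj1 Had).
  assert (Hne : (-1) ^ r * P r b <> 0).
  { apply Rmult_integral_contrapositive_currified; [apply pow_nonzero; lra | exact Hex]. }
  destruct (Rtotal_order 0 ((-1) ^ r * P r b)) as [H | [H | H]]; [exact H | lra | exfalso].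
  (* The tolerance is the distance from the supposed negative limit to 0, so the quotient would be
     negative near b, where P and (b - y)^r are positive. *)
  destruct (taylor_limit_left P b r (proj1 HV) Hb (- ((-1) ^ r * P r b))) as [d [Hd Hl]]; [lra |].
  set (y := Rmax (b - d / 2) ((a + b) / 2)).
  assert (Hy1 := Rmax_l (b - d / 2) ((a + b) / 2)); assert (Hy2 := Rmax_r (b - d / 2) ((a + b) / 2)).
  assert (Hy3 : y < b) by (apply Rmax_lub_lt; lra); fold y in Hy1, Hy2.
  specialize (Hl y ltac:(lra)); apply Rabs_def2 in Hl.
  assert (Hq : 0 < P 0%nat y / ((b - y) ^ r / INR (fact r))); [| lra].
  apply Rdiv_lt_0_compat; [apply Hpos; lra |].
  apply Rdiv_lt_0_compat; [apply pow_lt; lra | apply INR_fact_lt_0].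
Qed.

(** * Left limits at b and reality of the chosen basis elements *)

Lemma Cmod_RtoC (r : R) : Cmod (RtoC r) = Rabs r.
Proof.
  unfold Cmod; simpl; replace (r * (r * 1) + 0 * (0 * 1)) with (Rsqr r) by (unfold Rsqr; ring).
  apply sqrt_Rsqr_abs.
Qed.

Lemma Cmod_le_Rabs (z : Cx) : Cmod z <= Rabs (cre z) + Rabs (cim z).
Proof.
  assert (H1 := Rabs_pos (cre z)); assert (H2 := Rabs_pos (cim z)).
  unfold Cmod; rewrite <- (sqrt_Rsqr (Rabs (cre z) + Rabs (cim z))) by lra.
  apply sqrt_le_1_alt; unfold Rsqr; rewrite <- !pow2_abs with (x := cre z), <- pow2_abs with (x := cim z); nra.
Qed.

Lemma Rabs_cre_le (z : Cx) : Rabs (cre z) <= Cmod z.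
Proof.
  unfold Cmod; rewrite <- (sqrt_Rsqr_abs (cre z)); apply sqrt_le_1_alt.
  unfold Rsqr; nra.
Qed.

Lemma Rabs_cim_le (z : Cx) : Rabs (cim z) <= Cmod z.
Proof.
  unfold Cmod; rewrite <- (sqrt_Rsqr_abs (cim z)); apply sqrt_le_1_alt.
  unfold Rsqr; nra.
Qed.

Lemma limL_unique (g : R -> Cx) (b : R) (L : Cx) : is_lim_left g b L -> limL g b = L.
Proof.
  intros HL.
  assert (HL' : is_lim_left g b (limL g b)).
  { apply (epsilon_spec Cx_inhabited (is_lim_left g b)); exists L; exact HL. }
  set (L' := limL g b) in *.
  (* [f] stands for [cre] or [cim]; the argument uses compatibility with subtraction and domination
     by the modulus. *)
  assert (E : forall f : Cx -> R, (forall z w, f (Csub z w) = f z - f w) ->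
    (forall z, Rabs (f z) <= Cmod z) -> f L' = f L).
  { intros f Hsub Hle; apply Rminus_diag_uniq.
    destruct (Req_dec (f L' - f L) 0) as [E | Hne]; [exact E | exfalso].
    apply Rabs_pos_lt in Hne; set (e := Rabs (f L' - f L)) in *.
    destruct (HL (e / 2)) as [d [Hd H]]; [lra |].
    destruct (HL' (e / 2)) as [d' [Hd' H']]; [lra |].
    set (x := b - Rmin d d' / 2).
    assert (H1 := Rmin_l d d'); assert (H2 := Rmin_r d d').
    assert (H3 : 0 < Rmin d d') by (apply Rmin_glb_lt; lra).
    specialize (H x ltac:(unfold x; lra)); specialize (H' x ltac:(unfold x; lra)).
    apply Rle_lt_trans with (1 := Hle _) in H; apply Rle_lt_trans with (1 := Hle _) in H'.
    rewrite Hsub in H, H'.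
    assert (H4 : e <= Rabs (f (g x) - f L) + Rabs (f (g x) - f L')).
    { unfold e; replace (f L' - f L) with ((f (g x) - f L) - (f (g x) - f L')) by ring.
      apply Rle_trans with (1 := Rabs_triang _ _); rewrite Rabs_Ropp; lra. }
    lra. }
  apply Cx_eq; apply E; auto using Rabs_cre_le, Rabs_cim_le.
Qed.

Lemma Cdiv_RtoC (x y : R) : Cdiv (RtoC x) (RtoC y) = RtoC (x / y).
Proof.
  destruct (Req_dec y 0) as [-> | Hy].
  - apply Cx_eq; simpl; unfold Rdiv; rewrite ?Rinv_0; ring.
  - apply Cx_eq; simpl; field; exact Hy.
Qed.

(** Both functions are divided by (b - x)^r / r!; the quotients tend to (-1)^r times the r-th
    derivatives at b, and the sign cancels. *)
Lemma limL_ratio (a b : R) (f g : R -> Cx) (F G : nat -> R -> R) (r : nat) :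
  a < b -> rtower F -> rtower G ->
  (forall x, a <= x <= b -> f x = RtoC (F 0%nat x)) ->
  (forall x, a <= x <= b -> g x = RtoC (G 0%nat x)) ->
  (forall j, (j < r)%nat -> F j b = 0) -> (forall j, (j < r)%nat -> G j b = 0) ->
  G r b <> 0 ->
  limL (fun x => Cdiv (f x) (g x)) b = RtoC (F r b / G r b).
Proof.
  intros Hab HF HG Hf Hg HFb HGb HGr; apply limL_unique.
  set (q := fun x => (b - x) ^ r / INR (fact r)).
  assert (Hs : (-1) ^ r <> 0) by (apply pow_nonzero; lra).
  assert (L : limit1_in (fun x => (F 0%nat x / q x) * / (G 0%nat x / q x)) (fun x => x < b)
    (((-1) ^ r * F r b) * / ((-1) ^ r * G r b)) b).
  { assert (T : forall H : nat -> R -> R, rtower H -> (forall j, (j < r)%nat -> H j b = 0) ->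
      limit1_in (fun x => H 0%nat x / q x) (fun x => x < b) ((-1) ^ r * H r b) b).
    { intros H HH HHb eps Heps.
      destruct (taylor_limit_left H b r HH HHb eps Heps) as [d [Hd Hl]].
      exists d; split; [exact Hd |]; intros x [Hx Hxd]; apply Hl.
      simpl in Hxd; unfold Rdist in Hxd; apply Rabs_def2 in Hxd; lra. }
    apply limit_mul; [apply T; assumption |].
    apply limit_inv; [apply T; assumption |].
    apply Rmult_integral_contrapositive_currified; assumption. }
  intros eps Heps; destruct (L eps Heps) as [d [Hd Hl]].
  exists (Rmin d (b - a)); split; [apply Rmin_glb_lt; lra |]; intros x Hx.
  assert (H1 := Rmin_l d (b - a)); assert (H2 := Rmin_r d (b - a)).
  rewrite Hf, Hg, Cdiv_RtoC by lra.
  replace (Csub (RtoC (F 0%nat x / G 0%nat x)) (RtoC (F r b / G r b)))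
    with (RtoC (F 0%nat x / G 0%nat x - F r b / G r b)) by (apply Cx_eq; simpl; ring).
  rewrite Cmod_RtoC; specialize (Hl x); simpl in Hl; unfold Rdist in Hl.
  assert (Hq : q x <> 0).
  { unfold q; apply Rgt_not_eq, Rdiv_lt_0_compat; [apply pow_lt; lra | apply INR_fact_lt_0]. }
  replace (F r b / G r b) with ((-1) ^ r * F r b * / ((-1) ^ r * G r b))
    by (field; split; assumption).
  replace (F 0%nat x / G 0%nat x) with (F 0%nat x / q x * / (G 0%nat x / q x)).
  - apply Hl; split; [lra |]; apply Rabs_def1; lra.
  - unfold Rdiv; rewrite Rinv_mult, Rinv_inv.
    transitivity (F 0%nat x * / G 0%nat x * (/ q x * q x)); [ring |].
    rewrite Rinv_l by exact Hq; ring.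
Qed.

(** The imaginary part of the chosen element vanishes to order k + 1 at a, because the k-th
    derivative there is the real number 1, and to order m - k at b; hence it is 0 on [a,b], the
    interval on which zeros are counted. *)
Lemma bern_real (a b M : R) (mus : list Cx) (k : nat) :
  admissible a b M mus -> (k < length mus)%nat ->
  exists P, isB a b mus k P /\
    (forall x, a <= x <= b -> bern a b mus k x = RtoC (P 0%nat x)) /\
    (forall x, a <= x <= b -> derivC (bern a b mus k) x = RtoC (P 1%nat x)).
Proof.
  intros Had Hk.
  assert (Hex : is_bernstein a b mus k (bern a b mus k)).
  { apply (epsilon_spec CxFun_inhabited (is_bernstein a b mus k)).
    destruct (isB_exists a b M mus k Had Hk) as [P HP].
    assert (Hr := isB_exact_order a b M mus k P Had Hk HP).
    destruct HP as [[HT HV] [Ha [Hka Hb]]].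
    assert (HC : deriv_tower (cplx P)).
    { intros j x; split; simpl; [apply HT | apply derivable_pt_lim_const]. }
    exists (cplx P 0%nat); split; exists (cplx P); (split; [exact HC | split; [reflexivity |]]).
    - exact HV.
    - unfold cplx; split; [intros j Hj; rewrite Ha by exact Hj; reflexivity |].
      split; [rewrite Hka; reflexivity |].
      split; [intros j Hj; rewrite Hb by exact Hj; reflexivity |].
      intros E; injection E; exact Hr. }
  destruct Hex as [[F' [HF' [HF'0 HV]]] [F [HF [HF0 [Ha [Hka [Hb _]]]]]]].
  assert (E : F' = F) by (apply deriv_tower_unique; [assumption | assumption | congruence]); subst F'.
  destruct (inV_cre_cim M mus F (proj2 (proj2 (proj2 Had))) HF HV) as [Hre Him].
  assert (Him0 : forall j x, a <= x <= b -> cim (F j x) = 0).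
  { apply (zero_of_endpoint_orders a b M mus (fun j x => cim (F j x)) (S k)
      (length mus - 1 - k) Had Him); [| | lia].
    - intros j Hj; destruct (Nat.eq_dec j k) as [-> | Hne]; [rewrite Hka; reflexivity |].
      rewrite Ha by lia; reflexivity.
    - intros j Hj; rewrite Hb by exact Hj; reflexivity. }
  exists (fun j x => cre (F j x)); split; [| split].
  - split; [exact Hre | split; [| split]].
    + intros j Hj; rewrite Ha by exact Hj; reflexivity.
    + rewrite Hka; reflexivity.
    + intros j Hj; rewrite Hb by exact Hj; reflexivity.
  - intros x Hx; rewrite <- HF0; apply Cx_eq; [reflexivity | apply Him0, Hx].
  - intros x Hx; rewrite <- HF0, (derivC_unique _ _ (HF 0%nat)).
    apply Cx_eq; [reflexivity | apply Him0, Hx].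
Qed.

(** * Expansion of exponentials *)

Lemma inV_zero (mus : list Cx) : inV mus (fun _ _ => 0).
Proof.
  split; [intros k x; apply derivable_pt_lim_const |]; intros x.
  replace (cplx (fun _ _ => 0))
    with (fun (k : nat) (x : R) => Cadd (Cmul C0 C0) (Cmul C0 C0)).
  - rewrite (applyOps_lincomb mus C0 C0 (fun _ _ => C0) (fun _ _ => C0)); ring.
  - extensionality k; extensionality y; apply Cx_eq; simpl; ring.
Qed.

(** A and B stand for Q_{k-1} and d_k Q_k; describing them by their values at the endpoints allows A
    = 0 for k = 0 and B = 0 for k = [length mus]. A cancels the leading term at a and B the one at
    b, which leaves k zeros at a and [length mus - k] at b. *)
Lemma ropD_isB_split (a b M l : R) (mus : list Cx) (k : nat) (P A B : nat -> R -> R) :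
  admissible a b M mus -> isB a b (RtoC l :: mus) k P -> (k <= length mus)%nat ->
  inV mus A -> inV mus B ->
  (forall j, (S j < k)%nat -> A j a = 0) -> (forall j, S j = k -> A j a = 1) ->
  (forall j, (j < length mus - k)%nat -> A j b = 0) ->
  (forall j, (j < k)%nat -> B j a = 0) ->
  (forall j, (j < length mus - 1 - k)%nat -> B j b = 0) ->
  (forall j, S j = (length mus - k)%nat -> B j b = P (S j) b) ->
  forall x, a <= x <= b -> ropD l P 0%nat x = A 0%nat x + B 0%nat x.
Proof.
  intros Had [HV [HPa [HPk HPb]]] Hk HA HB A1 A2 A3 B1 B2 B3 x Hx.
  assert (E : lincomb 1 (ropD l P) (-1) (lincomb 1 A 1 B) 0%nat x = 0).
  { apply (zero_of_endpoint_orders a b M mus _ k (length mus - k) Had); [| | | lia | exact Hx].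
    - apply inV_lincomb; [apply inV_ropD, HV | apply inV_lincomb; assumption].
    - intros j Hj; unfold lincomb, ropD; rewrite (HPa j), (B1 j) by lia.
      destruct (Nat.eq_dec (S j) k) as [Hjk | Hjk].
      + rewrite (A2 j), Hjk, HPk by exact Hjk; ring.
      + rewrite (A1 j), (HPa (S j)) by lia; ring.
    - intros j Hj; unfold lincomb, ropD; simpl in HPb.
      rewrite (HPb j), (A3 j) by lia.
      destruct (Nat.eq_dec (S j) (length mus - k)) as [Hjk | Hjk].
      + rewrite (B3 j) by exact Hjk; ring.
      + rewrite (B2 j), (HPb (S j)) by lia; ring. }
  unfold lincomb in E; lra.
Qed.

(* The coefficient d_k in (D - l) P_k = Q_{k-1} + d_k Q_k, read off from the leading terms at b. *)
Definition scale_at_b (b : R) (n : nat) (P Q : nat -> nat -> R -> R) (k : nat) : R :=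
  P k (n - k)%nat b / Q k (n - 1 - k)%nat b.

Section Expansion.

Context (a b M l : R) (mus : list Cx) (P Q : nat -> nat -> R -> R).
Hypothesis Had : admissible a b M mus.
Hypothesis HP : forall k, (k <= length mus)%nat -> isB a b (RtoC l :: mus) k (P k).
Hypothesis HQ : forall k, (k < length mus)%nat -> isB a b mus k (Q k).

Let d := scale_at_b b (length mus) P Q.

(** There is no Q_k for k = [length mus]. The value zero makes one recurrence cover the last element
    too and absorbs the meaningless value of [d] at that index. *)
Let Qz (k : nat) : nat -> R -> R := if lt_dec k (length mus) then Q k else fun _ _ => 0.

Lemma inV_Qz (k : nat) : inV mus (Qz k).
Proof.
  unfold Qz; destruct (lt_dec k (length mus)) as [Hk | Hk]; [apply HQ, Hk | apply inV_zero].
Qed.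

Lemma scaled_Qz (k : nat) : (k <= length mus)%nat ->
  (forall j, (j < k)%nat -> d k * Qz k j a = 0) /\
  (forall j, (j < length mus - 1 - k)%nat -> d k * Qz k j b = 0) /\
  (forall j, S j = (length mus - k)%nat -> d k * Qz k j b = P k (S j) b).
Proof.
  intros Hk; unfold Qz; destruct (lt_dec k (length mus)) as [Hlt | Hge].
  - destruct (HQ k Hlt) as [_ [Qa [_ Qb]]]; split; [| split].
    + intros j Hj; rewrite Qa by exact Hj; ring.
    + intros j Hj; rewrite Qb by exact Hj; ring.
    + intros j Hj; assert (Hex := isB_exact_order a b M mus k (Q k) Had Hlt (HQ k Hlt)).
      unfold d, scale_at_b; rewrite <- Hj.
      replace (length mus - 1 - k)%nat with j in * by lia; field; exact Hex.
  - split; [| split]; intros j Hj; [ring | ring | lia].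
Qed.

Lemma ropD_isB_first (x : R) : a <= x <= b -> ropD l (P 0%nat) 0%nat x = d 0%nat * Qz 0%nat 0%nat x.
Proof.
  intros Hx; destruct (scaled_Qz 0%nat ltac:(lia)) as [H1 [H2 H3]].
  rewrite (ropD_isB_split a b M l mus 0%nat (P 0%nat) (fun _ _ => 0)
    (lincomb (d 0%nat) (Qz 0%nat) 0 (Qz 0%nat)) Had); auto; unfold lincomb; try lia.
  - ring.
  - apply HP; lia.
  - apply inV_zero.
  - apply (inV_lincomb mus (d 0%nat) 0); apply inV_Qz.
  - intros j Hj; rewrite H2 by exact Hj; ring.
  - intros j Hj; rewrite H3 by exact Hj; ring.
Qed.

Lemma ropD_isB_next (k : nat) (x : R) : (k < length mus)%nat -> a <= x <= b ->
  ropD l (P (S k)) 0%nat x = Qz k 0%nat x + d (S k) * Qz (S k) 0%nat x.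
Proof.
  intros Hk Hx; destruct (scaled_Qz (S k) ltac:(lia)) as [H1 [H2 H3]].
  assert (E : Qz k = Q k) by (unfold Qz; destruct (lt_dec k (length mus)); [reflexivity | lia]).
  destruct (HQ k Hk) as [_ [Qa [Qk Qb]]].
  rewrite (ropD_isB_split a b M l mus (S k) (P (S k)) (Qz k)
    (lincomb (d (S k)) (Qz (S k)) 0 (Qz (S k))) Had); auto; unfold lincomb; try lia.
  - ring.
  - apply inV_Qz.
  - apply (inV_lincomb mus (d (S k)) 0); apply inV_Qz.
  - intros j Hj; rewrite E; apply Qa; lia.
  - intros j Hj; injection Hj as ->; rewrite E; exact Qk.
  - intros j Hj; rewrite E; apply Qb; lia.
  - intros j Hj; rewrite H1 by exact Hj; ring.
  - intros j Hj; rewrite H2 by exact Hj; ring.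
  - intros j Hj; rewrite H3 by exact Hj; ring.
Qed.

End Expansion.

Fixpoint neg_prod (d : nat -> R) (k : nat) : R :=
  match k with O => 1 | S k' => neg_prod d k' * - d k' end.

Lemma derivable_pt_lim_sum (f f' : nat -> R -> R) (n : nat) (x : R) :
  (forall k, (k <= n)%nat -> derivable_pt_lim (f k) x (f' k x)) ->
  derivable_pt_lim (fun y => sum_f_R0 (fun k => f k y) n) x (sum_f_R0 (fun k => f' k x) n).
Proof.
  induction n as [| n IH]; simpl; intros H; [apply H; lia |].
  apply (derivable_pt_lim_plus (fun y => sum_f_R0 (fun k => f k y) n) (f (S n)));
    [apply IH; intros; apply H; lia | apply H; lia].
Qed.

(* (D - l) applied to the sum telescopes to zero, so the sum is a multiple of e^{l x}. *)
Lemma exp_expansion (a b M l : R) (mus : list Cx) (P Q : nat -> nat -> R -> R) :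
  admissible a b M mus ->
  (forall k, (k <= length mus)%nat -> isB a b (RtoC l :: mus) k (P k)) ->
  (forall k, (k < length mus)%nat -> isB a b mus k (Q k)) ->
  forall x, a <= x <= b ->
  sum_f_R0 (fun k => exp (l * a) * neg_prod (scale_at_b b (length mus) P Q) k * P k 0%nat x)
    (length mus) = exp (l * x).
Proof.
  intros Had HP HQ; assert (Hab := proj1 Had).
  set (d := scale_at_b b (length mus) P Q).
  set (be := fun k => exp (l * a) * neg_prod d k).
  set (T := fun K j x => sum_f_R0 (fun k => be k * P k j x) K).
  set (Qz := fun k => if lt_dec k (length mus) then Q k else fun (_ : nat) (_ : R) => 0).
  assert (HT : forall K x, (K <= length mus)%nat -> a <= x <= b ->
    T K 1%nat x - l * T K 0%nat x = be K * (d K * Qz K 0%nat x)).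
  { intros K x HK Hx; induction K as [| K IH].
    - assert (E := ropD_isB_first a b M l mus P Q Had HP HQ x Hx).
      unfold ropD in E; fold d in E; fold (Qz 0%nat) in E.
      unfold T; simpl sum_f_R0; rewrite <- E; ring.
    - assert (E := ropD_isB_next a b M l mus P Q Had HP HQ K x ltac:(lia) Hx).
      unfold ropD in E; fold d in E; fold (Qz K) (Qz (S K)) in E.
      specialize (IH ltac:(lia)); unfold T in *; simpl sum_f_R0.
      replace (d (S K) * Qz (S K) 0%nat x)
        with (P (S K) 1%nat x - l * P (S K) 0%nat x - Qz K 0%nat x) by lra.
      transitivity (be K * (d K * Qz K 0%nat x)
        + be (S K) * (P (S K) 1%nat x - l * P (S K) 0%nat x)); [lra |].
      unfold be; simpl; ring. }
  assert (Hlast : forall x, Qz (length mus) 0%nat x = 0).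
  { intros x; unfold Qz; destruct (lt_dec (length mus) (length mus)); [lia | reflexivity]. }
  set (N := length mus) in *.
  assert (Hz : forall x, a <= x <= b -> T N 0%nat x - exp (l * x) = 0).
  { apply (zero_from_derive a b (fun y => exp (- l * y)) (fun y => T N 0%nat y - exp (l * y))
      (fun y => exp (- l * y) * (T N 1%nat y - l * T N 0%nat y)) a).
    - intros y Hy; eapply derivable_pt_lim_value.
      + apply (derivable_pt_lim_mult (fun y => exp (- l * y)) (fun y => T N 0%nat y - exp (l * y))).
        * apply is_derive_Reals; auto_derive; [auto | reflexivity].
        * apply (derivable_pt_lim_minus (T N 0%nat) (fun y => exp (l * y))).
          -- apply (derivable_pt_lim_sum (fun k y => be k * P k 0%nat y)
               (fun k y => be k * P k 1%nat y)).
             intros k Hk; apply (derivable_pt_lim_scal (P k 0%nat)), (proj1 (proj1 (HP k Hk))).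
          -- apply is_derive_Reals; auto_derive; [auto | reflexivity].
      + unfold T; ring.
    - intros y Hy; rewrite HT, Hlast by (auto; lia); ring.
    - intros y Hy; apply Rgt_not_eq, exp_pos.
    - lra.
    - assert (E : forall K, (K <= N)%nat -> T K 0%nat a = exp (l * a)).
      { intros K HK; unfold T; induction K as [| K IH]; simpl.
        - destruct (HP 0%nat ltac:(lia)) as [_ [_ [E _]]]; rewrite E; unfold be; simpl; ring.
        - destruct (HP (S K) HK) as [_ [E _]]; rewrite E, IH by lia; ring. }
      rewrite E by lia; ring. }
  intros x Hx; specialize (Hz x Hx); unfold T, be in Hz; lra.
Qed.

(** The order of P_k at b exceeds that of Q_k by one, so their leading derivatives there have
    opposite signs. *)
Lemma scale_at_b_neg (a b M l : R) (mus : list Cx) (P Q : nat -> nat -> R -> R) (k : nat) :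
  admissible a b M mus -> (k < length mus)%nat ->
  isB a b (RtoC l :: mus) k (P k) -> isB a b mus k (Q k) ->
  scale_at_b b (length mus) P Q k < 0.
Proof.
  intros Had Hk HP HQ.
  assert (H1 := isB_sign_right a b M _ k (P k) (admissible_cons _ _ _ l _ Had)
    ltac:(simpl; lia) HP).
  assert (H2 := isB_sign_right a b M _ k (Q k) Had Hk HQ).
  unfold scale_at_b; simpl length in H1.
  replace (S (length mus) - 1 - k)%nat with (S (length mus - 1 - k)) in H1 by lia.
  replace (length mus - k)%nat with (S (length mus - 1 - k)) by lia.
  set (r := (length mus - 1 - k)%nat) in *; simpl in H1.
  assert (Hs : (-1) ^ r <> 0) by (apply pow_nonzero; lra).
  assert (HQr : Q k r b <> 0) by (intros E; rewrite E in H2; lra).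
  replace (P k (S r) b / Q k r b)
    with (- ((-1 * (-1) ^ r * P k (S r) b) / ((-1) ^ r * Q k r b)))
    by (field; split; assumption).
  apply Ropp_lt_gt_0_contravar, Rdiv_lt_0_compat; assumption.
Qed.

Lemma neg_prod_pos (d : nat -> R) (k : nat) :
  (forall j, (j < k)%nat -> d j < 0) -> 0 < neg_prod d k.
Proof.
  induction k as [| k IH]; simpl; intros H; [lra |].
  apply Rmult_lt_0_compat; [apply IH; intros; apply H; lia |].
  specialize (H k ltac:(lia)); lra.
Qed.

Lemma isB_nonneg (a b M : R) (mus : list Cx) (k : nat) (P : nat -> R -> R) :
  admissible a b M mus -> (k < length mus)%nat -> isB a b mus k P ->
  forall x, a <= x <= b -> 0 <= P 0%nat x.
Proof.
  intros Had Hk HP x Hx; assert (Hab := proj1 Had).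
  destruct (Req_dec x a) as [-> | Hxa].
  - destruct HP as [_ [Ha [Hka _]]]; destruct k as [| k]; [| rewrite Ha by lia]; lra.
  - destruct (Req_dec x b) as [-> | Hxb].
    + assert (Hs := isB_sign_right a b M mus k P Had Hk HP).
      destruct HP as [_ [_ [_ Hb]]].
      destruct (length mus - 1 - k)%nat as [| r]; [simpl in Hs; lra | rewrite Hb by lia; lra].
    + apply Rlt_le, (isB_pos a b M mus k P Had Hk HP); lra.
Qed.

(* With N = length mus, (D - l0) f - (D - l1) g has order k at a and N-1-k at b, so it is a
   multiple c s of the k-th Bernstein element of mus; a ratio >= 1 would force c <= 0, and then
   e^{-l0 x} (f - g) would decrease strictly from 0. *)
Lemma endpoint_ratio_lt_1 (a b M l0 l1 : R) (mus : list Cx) (k : nat) (f g : nat -> R -> R) :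
  l0 < l1 -> admissible a b M mus -> (k <= length mus)%nat ->
  isB a b (RtoC l0 :: mus) k f -> isB a b (RtoC l1 :: mus) k g ->
  0 < f (length mus - k)%nat b / g (length mus - k)%nat b < 1.
Proof.
  intros Hl Had Hk Hf Hg; assert (Hab := proj1 Had).
  assert (Hk' : (k < S (length mus))%nat) by lia.
  assert (Hf0 := admissible_cons a b M l0 mus Had); assert (Hg0 := admissible_cons a b M l1 mus Had).
  assert (Sf := isB_sign_right _ _ _ _ _ _ Hf0 Hk' Hf).
  assert (Sg := isB_sign_right _ _ _ _ _ _ Hg0 Hk' Hg).
  assert (Pg := isB_pos _ _ _ _ _ _ Hg0 Hk' Hg).
  simpl length in Sf, Sg.
  replace (S (length mus) - 1 - k)%nat with (length mus - k)%nat in Sf, Sg by lia.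
  destruct Hf as [Vf [fa [fk fb]]], Hg as [Vg [ga [gk gb]]]; simpl length in fb, gb.
  set (r := (length mus - k)%nat) in *.
  assert (Hs : (-1) ^ r <> 0) by (apply pow_nonzero; lra).
  assert (Hgr : g r b <> 0) by (intros E; rewrite E in Sg; lra).
  assert (Er : f r b / g r b = ((-1) ^ r * f r b) / ((-1) ^ r * g r b))
    by (field; split; assumption).
  rewrite Er; split; [apply Rdiv_lt_0_compat; assumption |].
  apply Rlt_div_l; [exact Sg |]; rewrite Rmult_1_l.
  apply Rnot_le_lt; intros Hge.
  assert (HD : exists S0 : R -> R, (forall x, a < x < b -> S0 x <= 0) /\
    forall x, a <= x <= b -> ropD l0 f 0%nat x = ropD l1 g 0%nat x + S0 x).
  { destruct (Nat.eq_dec k (length mus)) as [Ek | Nk].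
    - exists (fun _ => 0); split; [intros; lra |]; intros x Hx.
      enough (E : lincomb 1 (ropD l0 f) (-1) (ropD l1 g) 0%nat x = 0)
        by (unfold lincomb in E; lra).
      apply (zero_of_endpoint_orders a b M mus _ k 0 Had); [| | intros; lia | lia | exact Hx].
      + apply inV_lincomb; apply inV_ropD; assumption.
      + intros j Hj; unfold lincomb, ropD; rewrite (fa j), (ga j) by lia.
        destruct (Nat.eq_dec (S j) k) as [-> | Hjk]; [rewrite fk, gk; ring |].
        rewrite fa, ga by lia; ring.
    - assert (Hk'' : (k < length mus)%nat) by lia.
      destruct (isB_exists a b M mus k Had Hk'') as [s Hsb].
      assert (Ss := isB_sign_right _ _ _ _ _ _ Had Hk'' Hsb).
      assert (Ps := isB_pos _ _ _ _ _ _ Had Hk'' Hsb).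
      destruct Hsb as [Vs [sa [_ sb]]].
      set (q := (length mus - 1 - k)%nat) in *.
      assert (Hrq : r = S q) by (unfold r, q; lia).
      assert (Hsq : s q b <> 0) by (intros E; rewrite E in Ss; lra).
      set (c := (f r b - g r b) / s q b).
      assert (Hc : c <= 0).
      { unfold c.
        replace ((f r b - g r b) / s q b)
          with (- (((-1) ^ r * f r b - (-1) ^ r * g r b) / ((-1) ^ q * s q b))).
        - enough (0 <= ((-1) ^ r * f r b - (-1) ^ r * g r b) / ((-1) ^ q * s q b)) by lra.
          apply Rdiv_le_0_compat; [lra | exact Ss].
        - rewrite Hrq; simpl; field; split; [exact Hsq | apply pow_nonzero; lra]. }
      exists (fun x => c * s 0%nat x); split.
      + intros x Hx; specialize (Ps x Hx); nra.
      + intros x Hx.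
        enough (E : lincomb 1 (lincomb 1 (ropD l0 f) (-1) (ropD l1 g)) (- c) s 0%nat x = 0)
          by (unfold lincomb in E; lra).
        apply (zero_of_endpoint_orders a b M mus _ k r Had); [| | | unfold r; lia | exact Hx].
        * apply inV_lincomb; [apply inV_lincomb; apply inV_ropD; assumption | exact Vs].
        * intros j Hj; unfold lincomb, ropD; rewrite (fa j), (ga j), (sa j) by lia.
          destruct (Nat.eq_dec (S j) k) as [-> | Hjk]; [rewrite fk, gk; ring |].
          rewrite fa, ga by lia; ring.
        * intros j Hj; unfold lincomb, ropD; rewrite (fb j), (gb j) by lia.
          destruct (Nat.eq_dec j q) as [-> | Hjk].
          -- rewrite <- Hrq; unfold c; field; exact Hsq.
          -- rewrite (fb (S j)), (gb (S j)), (sb j) by lia; ring. }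
  destruct HD as [S0 [HS0 HD]].
  set (h := fun x => exp (- l0 * x) * (f 0%nat x - g 0%nat x)).
  destruct (MVT_cor2 h (fun x => exp (- l0 * x) * (ropD l0 f 0%nat x - ropD l0 g 0%nat x)) a b Hab)
    as [z [Hz Hzab]].
  { intros x Hx; eapply derivable_pt_lim_value.
    - apply (derivable_pt_lim_mult (fun x => exp (- l0 * x)) (fun x => f 0%nat x - g 0%nat x)).
      + apply is_derive_Reals; auto_derive; [auto | reflexivity].
      + apply (derivable_pt_lim_minus (f 0%nat) (g 0%nat)); [apply (proj1 Vf) | apply (proj1 Vg)].
    - unfold ropD; ring. }
  assert (Hha : h a = 0).
  { unfold h; destruct k as [| k]; [rewrite fk, gk | rewrite fa, ga by lia]; ring. }
  assert (Hneg : h b < 0).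
  { assert (Ez : h b = exp (- l0 * z) * (ropD l0 f 0%nat z - ropD l0 g 0%nat z) * (b - a)) by lra.
    rewrite Ez, HD by lra; unfold ropD.
    specialize (HS0 z Hzab); specialize (Pg z Hzab); assert (He := exp_pos (- l0 * z)).
    (* The expression is S0 - (l1 - l0) g at z, with S0 <= 0 and g > 0. *)
    assert (Hq : g 1%nat z - l1 * g 0%nat z + S0 z - (g 1%nat z - l0 * g 0%nat z) < 0) by nra.
    apply Ropp_lt_cancel; rewrite Ropp_0, Ropp_mult_distr_l, Ropp_mult_distr_r.
    apply Rmult_lt_0_compat; [apply Rmult_lt_0_compat |]; lra. }
  unfold h in Hneg; assert (He := exp_pos (- l0 * b)).
  (* For k = [length mus] the ratio is that of the values f(b) and g(b), so the assumption
     contradicts h(b) < 0 directly; otherwise both vanish at b and h(b) = 0. *)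
  destruct (Nat.eq_dec k (length mus)) as [Ek | Nk].
  - replace r with 0%nat in Hge by (unfold r; lia); simpl in Hge; nra.
  - rewrite fb, gb in Hneg by lia; lra.
Qed.

(** * A Korovkin theorem for exponentials *)

(** The integral of e^{q s} - e^{p s} over s from 0 to y. For p < q it vanishes only at 0 and is
    positive elsewhere; it replaces (t - x)^2 in Korovkin's argument. *)
Definition exp_gap (p q y : R) : R := (exp (q * y) - 1) / q - (exp (p * y) - 1) / p.

Lemma exp_gap_derive (p q y : R) : p <> 0 -> q <> 0 ->
  derivable_pt_lim (exp_gap p q) y (exp (q * y) - exp (p * y)).
Proof.
  intros Hp Hq; apply is_derive_Reals; unfold exp_gap; auto_derive; [auto |].
  field; split; assumption.
Qed.

Lemma exp_gap_incr_pos (p q y z : R) :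
  p < q -> p <> 0 -> q <> 0 -> 0 <= y -> y < z -> exp_gap p q y < exp_gap p q z.
Proof.
  intros Hpq Hp Hq Hy Hyz.
  destruct (MVT_cor2 (exp_gap p q) (fun y => exp (q * y) - exp (p * y)) y z Hyz) as [c [Hc Hc']].
  { intros c _; apply exp_gap_derive; assumption. }
  assert (exp (p * c) < exp (q * c)) by (apply exp_increasing; nra); nra.
Qed.

Lemma exp_gap_decr_neg (p q y z : R) :
  p < q -> p <> 0 -> q <> 0 -> y < z -> z <= 0 -> exp_gap p q z < exp_gap p q y.
Proof.
  intros Hpq Hp Hq Hyz Hz.
  destruct (MVT_cor2 (exp_gap p q) (fun y => exp (q * y) - exp (p * y)) y z Hyz) as [c [Hc Hc']].
  { intros c _; apply exp_gap_derive; assumption. }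
  assert (exp (q * c) < exp (p * c)) by (apply exp_increasing; nra); nra.
Qed.

Lemma exp_gap_0 (p q : R) : exp_gap p q 0 = 0.
Proof. unfold exp_gap, Rdiv; rewrite !Rmult_0_r, exp_0; ring. Qed.

Lemma exp_gap_lower (p q d : R) : p < q -> p <> 0 -> q <> 0 -> 0 < d ->
  (forall y, 0 <= exp_gap p q y) /\
  exists c, 0 < c /\ forall y, d <= Rabs y -> c <= exp_gap p q y.
Proof.
  intros Hpq Hp Hq Hd; assert (H0 := exp_gap_0 p q); split.
  - intros y; destruct (Rtotal_order y 0) as [H | [-> | H]]; [| lra |].
    + assert (H1 := exp_gap_decr_neg p q y 0 Hpq Hp Hq H (Rle_refl _)); lra.
    + assert (H1 := exp_gap_incr_pos p q 0 y Hpq Hp Hq (Rle_refl _) H); lra.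
  - exists (Rmin (exp_gap p q d) (exp_gap p q (- d))).
    assert (H1 := exp_gap_incr_pos p q 0 d Hpq Hp Hq (Rle_refl _) Hd).
    assert (H2 := exp_gap_decr_neg p q (- d) 0 Hpq Hp Hq ltac:(lra) (Rle_refl _)).
    split; [apply Rmin_glb_lt; lra |]; intros y Hy.
    assert (M1 := Rmin_l (exp_gap p q d) (exp_gap p q (- d))).
    assert (M2 := Rmin_r (exp_gap p q d) (exp_gap p q (- d))).
    destruct (Rle_or_lt 0 y) as [Hy0 | Hy0].
    + rewrite Rabs_pos_eq in Hy by exact Hy0; destruct Hy as [Hy | <-]; [| lra].
      assert (H3 := exp_gap_incr_pos p q d y Hpq Hp Hq ltac:(lra) Hy); lra.
    + rewrite Rabs_left in Hy by exact Hy0.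
      destruct (Req_dec y (- d)) as [-> | Hne]; [lra |].
      assert (H3 := exp_gap_decr_neg p q y (- d) Hpq Hp Hq ltac:(lra) ltac:(lra)); lra.
Qed.

Definition cont_on (a b : R) (f : R -> R) : Prop :=
  forall x, a <= x <= b -> forall eps, eps > 0 -> exists d, d > 0 /\
    forall y, a <= y <= b -> Rabs (y - x) < d -> Rabs (f y - f x) < eps.

(** Composition with [clamp] extends a function continuous on [a,b] to the whole line, so that
    [continuity_pt] and the compactness theorems apply. *)
Definition clamp (a b x : R) : R := Rmax a (Rmin b x).

Lemma clamp_bounds (a b x : R) : a <= b -> a <= clamp a b x <= b.
Proof.
  intros H; unfold clamp; split; [apply Rmax_l |].
  apply Rmax_lub; [exact H | apply Rmin_l].
Qed.

Lemma clamp_id (a b x : R) : a <= x <= b -> clamp a b x = x.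
Proof. intros H; unfold clamp; rewrite Rmin_right, Rmax_right; lra. Qed.

Lemma clamp_lipschitz (a b x y : R) : a <= b -> Rabs (clamp a b y - clamp a b x) <= Rabs (y - x).
Proof.
  intros H; unfold clamp, Rmin; destruct (Rle_dec b x), (Rle_dec b y); unfold Rmax;
  repeat match goal with |- context [Rle_dec ?u ?v] => destruct (Rle_dec u v) end;
    unfold Rabs; repeat match goal with |- context [Rcase_abs ?u] => destruct (Rcase_abs u) end; lra.
Qed.

Lemma cont_on_clamp (a b : R) (f : R -> R) : a <= b -> cont_on a b f ->
  forall x, continuity_pt (fun y => f (clamp a b y)) x.
Proof.
  intros Hab Hf x eps Heps.
  destruct (Hf (clamp a b x) (clamp_bounds a b x Hab) eps Heps) as [d [Hd H]].
  exists d; split; [exact Hd |]; intros y [_ Hy]; simpl in *; unfold Rdist in *.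
  apply H; [apply clamp_bounds, Hab |].
  apply Rle_lt_trans with (2 := Hy), clamp_lipschitz, Hab.
Qed.

Lemma sum_lincomb (c d : R) (u v : nat -> R) (n : nat) :
  sum_f_R0 (fun k => c * u k + d * v k) n = c * sum_f_R0 u n + d * sum_f_R0 v n.
Proof. induction n as [| n IH]; simpl; [ring | rewrite IH; ring]. Qed.

(** Dividing by e^{l0 x} normalises the problem: the weights w_k e^{l0 (t_k - x)} sum to 1 and the
    test functions become 1, e^{mu y}, e^{nu y} in y = t_k - x. Choosing [tau] before n, the nodes,
    the weights and x is what makes the conclusion uniform. *)
Lemma korovkin_exp (a b l0 l1 l2 : R) (f : R -> R) :
  a < b -> l0 < l1 -> l2 <> l0 -> l2 <> l1 -> cont_on a b f ->
  forall eps, 0 < eps -> exists tau, 0 < tau /\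
  forall (n : nat) (t w : nat -> R) (x : R), a <= x <= b ->
    (forall k, (k <= n)%nat -> 0 <= w k) -> (forall k, (k <= n)%nat -> a <= t k <= b) ->
    sum_f_R0 (fun k => w k * exp (l0 * t k)) n = exp (l0 * x) ->
    sum_f_R0 (fun k => w k * exp (l1 * t k)) n = exp (l1 * x) ->
    Rabs (sum_f_R0 (fun k => w k * exp (l2 * t k)) n - exp (l2 * x)) <= tau * exp (l2 * x) ->
    Rabs (sum_f_R0 (fun k => w k * f (t k)) n - f x) < eps.
Proof.
  intros Hab H01 H20 H21 Hf eps Heps.
  set (g := fun y => f (clamp a b y) * exp (- l0 * y)).
  assert (Hg : forall y, continuity_pt g y).
  { intros y; apply (continuity_pt_mult (fun y => f (clamp a b y)) (fun y => exp (- l0 * y))).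
    - apply cont_on_clamp; [lra | exact Hf].
    - apply derivable_continuous_pt; exists (- l0 * exp (- l0 * y)).
      apply is_derive_Reals; auto_derive; [auto | ring]. }
  set (E := exp (Rabs l0 * (Rabs a + Rabs b))).
  assert (HE : 0 < E) by apply exp_pos.
  assert (HE' : forall x, a <= x <= b -> exp (l0 * x) <= E).
  { intros x Hx; unfold E.
    assert (Hle : l0 * x <= Rabs l0 * (Rabs a + Rabs b)).
    { apply Rle_trans with (1 := Rle_abs _); rewrite Rabs_mult.
      apply Rmult_le_compat_l; [apply Rabs_pos |].
      unfold Rabs; repeat match goal with |- context [Rcase_abs ?u] => destruct (Rcase_abs u) end; lra. }
    destruct Hle as [Hlt | ->]; [apply Rlt_le, exp_increasing, Hlt | lra]. }
  assert (He1 : 0 < eps / (4 * E)) by (apply Rdiv_lt_0_compat; lra).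
  destruct (@Heine_cor2 g a b (fun x _ => Hg x) (mkposreal _ He1))
    as [del Hdel]; simpl in Hdel.
  destruct (continuity_ab_maj (fun y => Rabs (g y)) a b) as [xm [Hmaj _]]; [lra | |].
  { intros y _; apply (continuity_pt_comp g Rabs); [apply Hg | apply Rcontinuity_abs]. }
  set (B := Rabs (g xm) + 1) in *.
  assert (HB : 0 < B) by (assert (H := Rabs_pos (g xm)); unfold B; lra).
  set (mu := l1 - l0); set (nu := l2 - l0).
  assert (Hmu : mu <> 0) by (unfold mu; lra); assert (Hnu : nu <> 0) by (unfold nu; lra).
  (* [exp_gap_lower] wants the smaller frequency first; the sign [s] records whether that is mu or
     nu. *)
  assert (HH : exists (H : R -> R) (c s : R), 0 < c /\ Rabs s = 1 /\
    (forall y, 0 <= H y) /\ (forall y, del <= Rabs y -> c <= H y) /\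
    forall y, H y = s * ((exp (nu * y) - 1) / nu - (exp (mu * y) - 1) / mu)).
  { assert (Hd := cond_pos del).
    destruct (Rtotal_order mu nu) as [Hlt | [Heq | Hgt]].
    - destruct (exp_gap_lower mu nu del Hlt Hmu Hnu Hd) as [P1 [c [Hc P2]]].
      exists (exp_gap mu nu), c, 1; repeat split; auto; [apply Rabs_R1 |].
      intros y; unfold exp_gap; ring.
    - unfold mu, nu in Heq; lra.
    - destruct (exp_gap_lower nu mu del Hgt Hnu Hmu Hd) as [P1 [c [Hc P2]]].
      exists (exp_gap nu mu), c, (-1); repeat split; auto.
      + rewrite Rabs_left; lra.
      + intros y; unfold exp_gap; ring. }
  destruct HH as [H [c [s [Hc [Hs [H0 [Hlow HE0]]]]]]].
  assert (Hnu' : 0 < Rabs nu) by (apply Rabs_pos_lt, Hnu).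
  (* Solves (2 B / c) (tau / |nu|) = eps / (4 E), so that the far nodes contribute as much as the
     near ones. *)
  set (tau := Rabs nu * c / (2 * B) * (eps / (4 * E))).
  assert (Htau : 0 < tau).
  { unfold tau; apply Rmult_lt_0_compat; [| exact He1].
    apply Rdiv_lt_0_compat; [apply Rmult_lt_0_compat; assumption | lra]. }
  exists tau; split; [exact Htau |].
  intros n t w x Hx Hw Ht S0 S1 S2.
  set (v := fun k => w k * exp (l0 * (t k - x))).
  assert (Hv : forall k, (k <= n)%nat -> 0 <= v k).
  { intros k Hk; apply Rmult_le_pos; [apply Hw, Hk | apply Rlt_le, exp_pos]. }
  assert (Hsh : forall l, sum_f_R0 (fun k => v k * exp ((l - l0) * (t k - x))) n
    = exp (- l * x) * sum_f_R0 (fun k => w k * exp (l * t k)) n).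
  { intros l; rewrite scal_sum; apply sum_eq; intros k _; unfold v.
    rewrite Rmult_assoc, <- exp_plus, Rmult_assoc, <- exp_plus; f_equal; f_equal; ring. }
  assert (Hee : forall l, exp (- l * x) * exp (l * x) = 1).
  { intros l; rewrite <- exp_plus; replace (- l * x + l * x) with 0 by ring; apply exp_0. }
  assert (V0 : sum_f_R0 v n = 1).
  { rewrite <- (Hee l0), <- S0, <- Hsh; apply sum_eq; intros k _.
    replace ((l0 - l0) * (t k - x)) with 0 by ring; rewrite exp_0; ring. }
  assert (V1 : sum_f_R0 (fun k => v k * exp (mu * (t k - x))) n = 1).
  { unfold mu; rewrite Hsh, S1; apply Hee. }
  assert (V2 : Rabs (sum_f_R0 (fun k => v k * exp (nu * (t k - x))) n - 1) <= tau).
  { unfold nu; rewrite Hsh, <- (Hee l2), <- Rmult_minus_distr_l, Rabs_mult.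
    rewrite (Rabs_pos_eq (exp _)) by apply Rlt_le, exp_pos.
    apply Rle_trans with (exp (- l2 * x) * (tau * exp (l2 * x))).
    - apply Rmult_le_compat_l; [apply Rlt_le, exp_pos | exact S2].
    - rewrite <- Rmult_assoc, (Rmult_comm _ tau), Rmult_assoc, Hee; lra. }
  (* The terms of H in 1 and e^{mu y} are reproduced exactly, so only the error of e^{nu y}, divided
     by nu, survives. *)
  assert (VH : sum_f_R0 (fun k => v k * H (t k - x)) n <= tau / Rabs nu).
  { replace (sum_f_R0 (fun k => v k * H (t k - x)) n)
      with (s * (sum_f_R0 (fun k => v k * exp (nu * (t k - x))) n - 1) / nu).
    - apply Rle_trans with (1 := Rle_abs _); unfold Rdiv.
      rewrite !Rabs_mult, Hs, Rmult_1_l, Rabs_inv.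
      apply Rmult_le_compat_r; [apply Rlt_le, Rinv_0_lt_compat, Hnu' | exact V2].
    - transitivity (s / nu * sum_f_R0 (fun k => v k * exp (nu * (t k - x))) n
        + 1 * sum_f_R0 (fun k => (- s / mu) * (v k * exp (mu * (t k - x)))
            + (s / mu - s / nu) * v k) n).
      + rewrite (sum_lincomb (- s / mu)), V1, V0; field; split; assumption.
      + rewrite <- sum_lincomb; apply sum_eq; intros k _; rewrite HE0; field; split; assumption. }
  (* Near x uniform continuity bounds the increment of g; at distance [del] or more it is at most 2
     B, which (2 B / c) H dominates. *)
  assert (Hbound : forall k, (k <= n)%nat ->
    Rabs (v k * (g (t k) - g x)) <= eps / (4 * E) * v k + 2 * B / c * (v k * H (t k - x))).
  { intros k Hk; rewrite Rabs_mult, (Rabs_pos_eq (v k)) by (apply Hv, Hk).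
    replace (eps / (4 * E) * v k + 2 * B / c * (v k * H (t k - x)))
      with (v k * (eps / (4 * E) + 2 * B / c * H (t k - x))) by ring.
    apply Rmult_le_compat_l; [apply Hv, Hk |].
    assert (HBc : 0 < 2 * B / c) by (apply Rdiv_lt_0_compat; lra).
    destruct (Rlt_or_le (Rabs (t k - x)) del) as [Hn | Hfar].
    - specialize (Hdel (t k) x (Ht k Hk) Hx Hn); specialize (H0 (t k - x)); nra.
    - specialize (Hlow _ Hfar).
      assert (G1 := Hmaj (t k) (Ht k Hk)); assert (G2 := Hmaj x Hx); simpl in G1, G2.
      assert (G3 := Rabs_triang (g (t k)) (- g x)); rewrite Rabs_Ropp in G3.
      assert (G4 : 2 * B / c * c <= 2 * B / c * H (t k - x))
        by (apply Rmult_le_compat_l; lra).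
      replace (2 * B / c * c) with (2 * B) in G4 by (field; lra).
      unfold Rminus, B in *; lra. }
  assert (Hsum : Rabs (sum_f_R0 (fun k => v k * (g (t k) - g x)) n) <= eps / (2 * E)).
  { apply Rle_trans with (1 := Rsum_abs _ _).
    apply Rle_trans with (1 := sum_Rle _ _ _ Hbound).
    rewrite sum_lincomb, V0.
    apply Rle_trans with (eps / (4 * E) * 1 + 2 * B / c * (tau / Rabs nu)).
    - apply Rplus_le_compat_l, Rmult_le_compat_l; [| exact VH].
      apply Rlt_le, Rdiv_lt_0_compat; lra.
    - right; unfold tau; field; repeat split; try lra. }
  assert (Eq : sum_f_R0 (fun k => w k * f (t k)) n - f x
    = exp (l0 * x) * sum_f_R0 (fun k => v k * (g (t k) - g x)) n).
  { transitivity (exp (l0 * x) * (1 * sum_f_R0 (fun k => v k * g (t k)) n + - g x * sum_f_R0 v n)).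
    - rewrite V0.
      replace (f x) with (exp (l0 * x) * g x).
      + replace (sum_f_R0 (fun k => w k * f (t k)) n)
          with (exp (l0 * x) * sum_f_R0 (fun k => v k * g (t k)) n); [ring |].
        rewrite scal_sum; apply sum_eq; intros k Hk; unfold v, g.
        rewrite clamp_id by (apply Ht, Hk).
        transitivity (w k * f (t k) * (exp (l0 * (t k - x)) * exp (- l0 * t k) * exp (l0 * x)));
          [ring |].
        rewrite <- !exp_plus.
        replace (l0 * (t k - x) + - l0 * t k + l0 * x) with 0 by ring; rewrite exp_0; ring.
      + unfold g; rewrite clamp_id by exact Hx.
        transitivity (f x * (exp (- l0 * x) * exp (l0 * x))); [ring | rewrite Hee; ring].
    - rewrite <- sum_lincomb; f_equal; apply sum_eq; intros k _; ring. }
  rewrite Eq, Rabs_mult, (Rabs_pos_eq (exp _)) by apply Rlt_le, exp_pos.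
  apply Rle_lt_trans with (E * (eps / (2 * E))).
  - apply Rmult_le_compat; [apply Rlt_le, exp_pos | apply Rabs_pos | apply HE', Hx | exact Hsum].
  - replace (E * (eps / (2 * E))) with (eps / 2) by (field; lra); lra.
Qed.

(** * The Bernstein operator *)

Lemma bern_family (a b M : R) (mus : list Cx) : admissible a b M mus ->
  exists P : nat -> nat -> R -> R, forall k, (k < length mus)%nat ->
    isB a b mus k (P k) /\
    (forall x, a <= x <= b -> bern a b mus k x = RtoC (P k 0%nat x)) /\
    (forall x, a <= x <= b -> derivC (bern a b mus k) x = RtoC (P k 1%nat x)).
Proof.
  intros Had.
  exists (fun k => epsilon (inhabits (fun _ _ => 0)) (fun P => isB a b mus k P /\
    (forall x, a <= x <= b -> bern a b mus k x = RtoC (P 0%nat x)) /\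
    (forall x, a <= x <= b -> derivC (bern a b mus k) x = RtoC (P 1%nat x)))).
  intros k Hk.
  apply (epsilon_spec (inhabits (fun _ _ => 0)) (fun P => isB a b mus k P /\
    (forall x, a <= x <= b -> bern a b mus k x = RtoC (P 0%nat x)) /\
    (forall x, a <= x <= b -> derivC (bern a b mus k) x = RtoC (P 1%nat x)))).
  apply (bern_real a b M); assumption.
Qed.

Lemma isB_perm (a b : R) (mus nus : list Cx) (k : nat) (P : nat -> R -> R) :
  Permutation mus nus -> isB a b mus k P -> isB a b nus k P.
Proof.
  intros Hp [HV [Ha [Hk Hb]]]; split; [apply (inV_perm mus), HV; exact Hp |].
  rewrite <- (Permutation_length Hp); auto.
Qed.

Lemma node_step_spec (a b l0 l1 L : R) (rest : list Cx) (k : nat) :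
  l0 < l1 -> 0 < L < 1 -> node_ratio a b l0 l1 rest k = RtoC L ->
  exp ((l0 - l1) * node_step a b l0 l1 rest k) = L /\ 0 < node_step a b l0 l1 rest k.
Proof.
  intros Hl HL E.
  assert (H : exp ((l0 - l1) * node_step a b l0 l1 rest k) = L).
  { assert (H : RtoC (exp ((l0 - l1) * node_step a b l0 l1 rest k)) = node_ratio a b l0 l1 rest k).
    { apply (epsilon_spec R_inhabited
        (fun d => RtoC (exp ((l0 - l1) * d)) = node_ratio a b l0 l1 rest k)).
      exists (ln L / (l0 - l1)); rewrite E.
      replace ((l0 - l1) * (ln L / (l0 - l1))) with (ln L) by (field; lra).
      rewrite exp_ln by lra; reflexivity. }
    rewrite E in H; injection H; auto. }
  split; [exact H |].
  set (s := node_step a b l0 l1 rest k) in *.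
  assert (Hneg : (l0 - l1) * s < 0); [| nra].
  apply exp_lt_inv; rewrite exp_0, H; lra.
Qed.

Lemma Csum_app (u v : list Cx) : Csum (u ++ v) = Cadd (Csum u) (Csum v).
Proof.
  induction u as [| z u IH]; simpl; [ring |].
  change (Cadd z (Csum (u ++ v)) = Cadd (Cadd z (Csum u)) (Csum v)); rewrite IH; ring.
Qed.

Lemma Cprod_app (u v : list Cx) : Cprod (u ++ v) = Cmul (Cprod u) (Cprod v).
Proof.
  induction u as [| z u IH]; simpl; [ring |].
  change (Cmul z (Cprod (u ++ v)) = Cmul (Cmul z (Cprod u)) (Cprod v)); rewrite IH; ring.
Qed.

Lemma Csum_seq (h : nat -> Cx) (n : nat) :
  Csum (map h (seq 0 (S n)))
  = mkCx (sum_f_R0 (fun k => cre (h k)) n) (sum_f_R0 (fun k => cim (h k)) n).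
Proof.
  induction n as [| n IH]; [apply Cx_eq; simpl; ring |].
  rewrite seq_S, map_app, Csum_app, IH; apply Cx_eq; simpl; ring.
Qed.

Lemma Cprod_seq_neg_prod (h : nat -> Cx) (d : nat -> R) (n : nat) :
  (forall k, (k < n)%nat -> h k = RtoC (d k)) ->
  Cprod (map h (seq 0 n)) = RtoC ((-1) ^ n * neg_prod d n).
Proof.
  induction n as [| n IH]; intros H; [apply Cx_eq; simpl; ring |].
  rewrite seq_S, map_app, Cprod_app, IH by (intros; apply H; lia); simpl map.
  rewrite (H n) by lia; apply Cx_eq; simpl; ring.
Qed.

Fixpoint prefix_sum (u : nat -> R) (k : nat) : R :=
  match k with O => 0 | S k' => prefix_sum u k' + u k' end.

Lemma sum_last_only (u : nat -> R) (n : nat) :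
  (forall k, (k < n)%nat -> u k = 0) -> sum_f_R0 u n = u n.
Proof.
  destruct n as [| n]; [reflexivity |]; intros H; simpl.
  rewrite (sum_eq u (fun _ => 0)) by (intros; apply H; lia).
  replace (sum_f_R0 (fun _ => 0) n) with 0; [ring |].
  clear; induction n as [| n IH]; simpl; [| rewrite <- IH]; ring.
Qed.

Lemma increasing_steps (t : nat -> R) (n : nat) :
  (forall k, (k < n)%nat -> t k < t (S k)) ->
  forall k, (k <= n)%nat -> t 0%nat <= t k <= t n.
Proof.
  intros H k Hk; split.
  - induction k as [| k IH]; [lra |]; specialize (IH ltac:(lia)); specialize (H k ltac:(lia)); lra.
  - remember (n - k)%nat as i eqn:Hi; revert k Hk Hi.
    induction i as [| i IH]; intros k Hk Hi; [replace k with n by lia; lra |].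
    specialize (IH (S k) ltac:(lia) ltac:(lia)); specialize (H k ltac:(lia)); lra.
Qed.

(** Gathers what the convergence argument needs, with weights w_k(x) = alpha_k P_k(x). The families
    Q0, Q1, Q2 belong to Lambda without l0, l1, l2 and give one expansion each over the same P_k;
    comparing d0, d1, d2 brings in the nodes and the ratios r. *)
Lemma bernstein_op_structure (a b M l0 l1 l2 : R) (tail : list Cx) :
  l0 < l1 -> admissible a b M tail ->
  let n := S (S (length tail)) in
  let t := node a b l0 l1 (RtoC l2 :: tail) in
  let r k := cre (limL (fun x => Cdiv (bern a b (RtoC l0 :: RtoC l1 :: tail) k x)
                                      (bern a b (RtoC l1 :: RtoC l2 :: tail) k x)) b) in
  exists w : nat -> R -> R,
    (forall k x, (k <= n)%nat -> a <= x <= b -> 0 <= w k x) /\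
    (forall k, (k < n)%nat -> t k < t (S k)) /\
    t n = b /\
    (forall x, a <= x <= b -> sum_f_R0 (fun k => w k x * exp (l0 * t k)) n = exp (l0 * x)) /\
    (forall x, a <= x <= b -> sum_f_R0 (fun k => w k x * exp (l1 * t k)) n = exp (l1 * x)) /\
    (forall x, a <= x <= b ->
       sum_f_R0 (fun k => w k x * exp (l2 * t k +
         prefix_sum (fun j => - ln (r j) - (l2 - l0) * (t (S j) - t j)) k)) n = exp (l2 * x)) /\
    (forall f x, a <= x <= b -> bernstein_op a b l0 l1 (RtoC l2 :: tail) f x
       = mkCx (sum_f_R0 (fun k => w k x * cre (f (t k))) n)
              (sum_f_R0 (fun k => w k x * cim (f (t k))) n)).
Proof.
  intros Hl Hadt n t r.
  assert (Had2 := admissible_cons a b M l2 _ Hadt).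
  assert (Had1 := admissible_cons a b M l1 _ Hadt).
  assert (Had12 := admissible_cons a b M l1 _ Had2).
  assert (Had02 := admissible_cons a b M l0 _ Had2).
  assert (Had01 := admissible_cons a b M l0 _ Had1).
  assert (Had012 := admissible_cons a b M l0 _ Had12).
  assert (Hab := proj1 Hadt).
  destruct (bern_family a b M _ Had012) as [P HP].
  destruct (bern_family a b M _ Had12) as [Q0 HQ0].
  destruct (bern_family a b M _ Had02) as [Q1 HQ1].
  destruct (bern_family a b M _ Had01) as [Q2 HQ2].
  simpl length in HP, HQ0, HQ1, HQ2; fold n in HP, HQ0, HQ1, HQ2.
  set (d0 := scale_at_b b n P Q0); set (d1 := scale_at_b b n P Q1); set (d2 := scale_at_b b n P Q2).
  assert (P0 : forall k, (k <= n)%nat ->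
    isB a b (RtoC l0 :: RtoC l1 :: RtoC l2 :: tail) k (P k)) by (intros k Hk; apply HP; lia).
  assert (P1 : forall k, (k <= n)%nat ->
    isB a b (RtoC l1 :: RtoC l0 :: RtoC l2 :: tail) k (P k)).
  { intros k Hk; apply (isB_perm a b _ _ k (P k)) with (2 := P0 k Hk); apply perm_swap. }
  assert (P2 : forall k, (k <= n)%nat ->
    isB a b (RtoC l2 :: RtoC l0 :: RtoC l1 :: tail) k (P k)).
  { intros k Hk; apply (isB_perm a b _ _ k (P k)) with (2 := P0 k Hk).
    apply (Permutation_sym (Permutation_middle [RtoC l0; RtoC l1] tail (RtoC l2))). }
  assert (N0 : forall k, (k < n)%nat -> d0 k < 0).
  { intros k Hk; apply (scale_at_b_neg a b M l0 _ P Q0 k Had12 Hk); [apply P0; lia | apply HQ0, Hk]. }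
  assert (N1 : forall k, (k < n)%nat -> d1 k < 0).
  { intros k Hk; apply (scale_at_b_neg a b M l1 _ P Q1 k Had02 Hk); [apply P1; lia | apply HQ1, Hk]. }
  assert (N2 : forall k, (k < n)%nat -> d2 k < 0).
  { intros k Hk; apply (scale_at_b_neg a b M l2 _ P Q2 k Had01 Hk); [apply P2; lia | apply HQ2, Hk]. }
  assert (X0 : forall k, (k < n)%nat -> Q0 k (n - 1 - k)%nat b <> 0).
  { intros k Hk; apply (isB_exact_order a b M _ k (Q0 k) Had12 Hk), HQ0, Hk. }
  assert (X1 : forall k, (k < n)%nat -> Q1 k (n - 1 - k)%nat b <> 0).
  { intros k Hk; apply (isB_exact_order a b M _ k (Q1 k) Had02 Hk), HQ1, Hk. }
  assert (X2 : forall k, (k < n)%nat -> Q2 k (n - 1 - k)%nat b <> 0).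
  { intros k Hk; apply (isB_exact_order a b M _ k (Q2 k) Had01 Hk), HQ2, Hk. }
  assert (XP : forall k, (k < n)%nat -> P k (n - k)%nat b <> 0).
  { intros k Hk E; specialize (N0 k Hk); unfold d0, scale_at_b, Rdiv in N0.
    rewrite E in N0; lra. }
  (* Since d0 and d1 have the same numerator, the ratio of Q1_k to Q0_k at b is d0_k / d1_k, and the
     equation defining the node step becomes a relation between d0 and d1. *)
  assert (Hstep : forall k, (k < n)%nat ->
    d0 k = d1 k * exp ((l0 - l1) * (t (S k) - t k)) /\ t k < t (S k)).
  { intros k Hk.
    assert (HL := endpoint_ratio_lt_1 a b M l0 l1 _ k (Q1 k) (Q0 k) Hl Had2
      ltac:(simpl length; unfold n in Hk; lia) (proj1 (HQ1 k Hk)) (proj1 (HQ0 k Hk))).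
    replace (length (RtoC l2 :: tail) - k)%nat with (n - 1 - k)%nat in HL by (unfold n; simpl; lia).
    destruct (node_step_spec a b l0 l1 _ (RtoC l2 :: tail) (S k) Hl HL) as [E1 E2].
    - unfold node_ratio; replace (S k - 1)%nat with k by lia.
      destruct (HQ1 k Hk) as [[V1 [_ [_ B1]]] [R1 _]], (HQ0 k Hk) as [[V0 [_ [_ B0]]] [R0 _]].
      apply (limL_ratio a b _ _ (Q1 k) (Q0 k)); auto; [apply V1 | apply V0].
    - replace (t (S k) - t k) with (node_step a b l0 l1 (RtoC l2 :: tail) (S k))
        by (unfold t; simpl; ring).
      split; [| unfold t; simpl; lra].
      rewrite E1; unfold d0, d1, scale_at_b; field; auto. }
  assert (Hr : forall k, (k < n)%nat -> d2 k = d0 k * exp (- ln (r k))).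
  { intros k Hk.
    assert (Er : r k = Q2 k (n - 1 - k)%nat b / Q0 k (n - 1 - k)%nat b).
    { unfold r; destruct (HQ2 k Hk) as [[V2 [_ [_ B2]]] [R2 _]], (HQ0 k Hk) as [[V0 [_ [_ B0]]] [R0 _]].
      rewrite (limL_ratio a b _ _ (Q2 k) (Q0 k) (n - 1 - k)); auto; [apply V2 | apply V0]. }
    assert (Er' : r k = d0 k / d2 k).
    { rewrite Er; unfold d0, d2, scale_at_b; field; auto. }
    specialize (N0 k Hk); specialize (N2 k Hk).
    assert (Hpos : 0 < r k).
    { rewrite Er'; replace (d0 k / d2 k) with ((- d0 k) / (- d2 k)) by (field; lra).
      apply Rdiv_lt_0_compat; lra. }
    rewrite exp_Ropp, exp_ln, Er' by exact Hpos; field; lra. }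
  (* [al] is alpha_k, as checked below against [bcoef]; [eta] accumulates the deviations of -ln r_j
     from (l2 - l0)(t_{j+1} - t_j). *)
  set (al := fun k => exp (- l0 * (t k - a)) * neg_prod d0 k).
  set (eta := prefix_sum (fun j => - ln (r j) - (l2 - l0) * (t (S j) - t j))).
  assert (C0' : forall k, exp (l0 * a) * neg_prod d0 k = al k * exp (l0 * t k)).
  { intros k; unfold al.
    replace (l0 * a) with (- l0 * (t k - a) + l0 * t k) by ring; rewrite exp_plus; ring. }
  assert (C1' : forall k, (k <= n)%nat -> exp (l1 * a) * neg_prod d1 k = al k * exp (l1 * t k)).
  { intros k; unfold al; induction k as [| k IH]; intros Hk.
    - unfold t; simpl; rewrite Rminus_diag, Rmult_0_r, exp_0; ring.
    - simpl neg_prod; rewrite <- Rmult_assoc, IH by lia.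
      destruct (Hstep k ltac:(lia)) as [E _]; rewrite E.
      transitivity (neg_prod d0 k * - d1 k * (exp (- l0 * (t k - a)) * exp (l1 * t k))); [ring |].
      transitivity (neg_prod d0 k * - d1 k * (exp (- l0 * (t (S k) - a))
        * exp ((l0 - l1) * (t (S k) - t k)) * exp (l1 * t (S k)))); [| ring].
      rewrite <- !exp_plus; f_equal; f_equal; ring. }
  assert (C2' : forall k, (k <= n)%nat ->
    exp (l2 * a) * neg_prod d2 k = al k * exp (l2 * t k + eta k)).
  { intros k; unfold al; induction k as [| k IH]; intros Hk.
    - unfold t; simpl; rewrite Rminus_diag, Rmult_0_r, exp_0, Rplus_0_r; ring.
    - simpl neg_prod; rewrite <- Rmult_assoc, IH, Hr by lia.
      transitivity (neg_prod d0 k * - d0 k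
        * (exp (- l0 * (t k - a)) * exp (l2 * t k + eta k) * exp (- ln (r k)))); [ring |].
      transitivity (neg_prod d0 k * - d0 k
        * (exp (- l0 * (t (S k) - a)) * exp (l2 * t (S k) + eta (S k)))); [| ring].
      rewrite <- !exp_plus; f_equal; f_equal; unfold eta; simpl prefix_sum; ring. }
  assert (S0 : forall x, a <= x <= b ->
    sum_f_R0 (fun k => al k * P k 0%nat x * exp (l0 * t k)) n = exp (l0 * x)).
  { intros x Hx.
    rewrite <- (exp_expansion a b M l0 _ P Q0 Had12 P0 (fun k Hk => proj1 (HQ0 k Hk)) x Hx).
    apply sum_eq; intros k Hk; fold n; fold d0; rewrite C0'; ring. }
  assert (S1 : forall x, a <= x <= b ->
    sum_f_R0 (fun k => al k * P k 0%nat x * exp (l1 * t k)) n = exp (l1 * x)).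
  { intros x Hx.
    rewrite <- (exp_expansion a b M l1 _ P Q1 Had02 P1 (fun k Hk => proj1 (HQ1 k Hk)) x Hx).
    apply sum_eq; intros k Hk; fold n; fold d1; rewrite C1' by exact Hk; ring. }
  exists (fun k x => al k * P k 0%nat x).
  split; [| split; [| split; [| split; [exact S0 | split; [exact S1 | split]]]]].
  - intros k x Hk Hx; apply Rmult_le_pos.
    + apply Rlt_le, Rmult_lt_0_compat; [apply exp_pos |].
      apply neg_prod_pos; intros j Hj; apply N0; lia.
    + apply (isB_nonneg a b M _ k (P k) Had012); [simpl length; unfold n in Hk; lia | apply P0, Hk | exact Hx].
  - intros k Hk; apply Hstep, Hk.
  (* At b only the last basis element survives, so the two reproduced exponentials give e^{l0 t_n} :
     e^{l1 t_n} = e^{l0 b} : e^{l1 b}, and l0 <> l1. *)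
  - assert (Hz : forall k, (k < n)%nat -> P k 0%nat b = 0).
    { intros k Hk; destruct (P0 k ltac:(lia)) as [_ [_ [_ B]]]; apply B.
      simpl length; unfold n in Hk; lia. }
    assert (E0 := S0 b ltac:(lra)); assert (E1 := S1 b ltac:(lra)).
    rewrite sum_last_only in E0, E1 by (intros k Hk; rewrite Hz by exact Hk; ring).
    assert (E : l0 * b + l1 * t n = l1 * b + l0 * t n); [| nra].
    apply exp_inv; rewrite !exp_plus, <- E0, <- E1; ring.
  - intros x Hx.
    rewrite <- (exp_expansion a b M l2 _ P Q2 Had01 P2 (fun k Hk => proj1 (HQ2 k Hk)) x Hx).
    apply sum_eq; intros k Hk; fold n; fold d2; fold (eta k); rewrite C2' by exact Hk; ring.
  - intros f x Hx; unfold bernstein_op; fold t.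
    replace (length (RtoC l2 :: tail) + 2)%nat with (S n) by (unfold n; simpl; lia).
    rewrite Csum_seq.
    assert (Hb : forall k, (k <= n)%nat -> bcoef a b l0 l1 (RtoC l2 :: tail) k = RtoC (al k)).
    { intros k Hk; unfold bcoef; fold t.
      rewrite (Cprod_seq_neg_prod _ d0).
      (* The sign (-1)^k in [bcoef] cancels the one that relates the product of the d0_j to
         [neg_prod]. *)
      - assert (Hs : (-1) ^ k * (-1) ^ k = 1)
          by (rewrite <- Rpow_mult_distr; replace (-1 * -1) with 1 by ring; apply pow1).
        apply Cx_eq; simpl; [| ring]; unfold al.
        transitivity (exp (- l0 * (t k - a)) * neg_prod d0 k * ((-1) ^ k * (-1) ^ k)); [ring |].
        rewrite Hs; ring.
      - intros j Hj; assert (Hjn : (j < n)%nat) by lia.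
        destruct (HP j ltac:(lia)) as [[V [_ [_ B]]] [_ RD]].
        destruct (HQ0 j Hjn) as [[V0 [_ [_ B0]]] [R0 _]].
        (* The shifted tower is that of P_j', whose order at b is the order n - 1 - j of Q0_j; the
           limit is therefore d0_j. *)
        rewrite (limL_ratio a b _ _ (fun i => P j (S i)) (Q0 j) (n - 1 - j)); auto.
        + unfold d0, scale_at_b; replace (n - j)%nat with (S (n - 1 - j)) by lia; reflexivity.
        + intros i y; apply (proj1 V).
        + apply V0.
        + intros i Hi; apply B; simpl length; unfold n in Hi; lia. }
    apply Cx_eq; cbn [cre cim]; apply sum_eq; intros k Hk; rewrite Hb by exact Hk;
      destruct (HP k ltac:(lia)) as [_ [Rk _]]; rewrite Rk by exact Hx; simpl; ring.
Qed.

(** * Accumulated errors and convergence *)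

Lemma prefix_sum_bound (u t : nat -> R) (e : R) (n : nat) :
  (forall k, (k < n)%nat -> Rabs (u k) <= e * (t (S k) - t k)) ->
  forall k, (k <= n)%nat -> Rabs (prefix_sum u k) <= e * (t k - t 0%nat).
Proof.
  intros H k; induction k as [| k IH]; simpl; intros Hk.
  - rewrite Rabs_R0, Rminus_diag; lra.
  - specialize (IH ltac:(lia)); specialize (H k ltac:(lia)).
    apply Rle_trans with (1 := Rabs_triang _ _); lra.
Qed.

Lemma sum_nonneg (u : nat -> R) (n : nat) :
  (forall k, (k <= n)%nat -> 0 <= u k) -> 0 <= sum_f_R0 u n.
Proof.
  induction n as [| n IH]; simpl; intros H; [apply H; lia |].
  apply Rplus_le_le_0_compat; [apply IH; intros |]; apply H; lia.
Qed.

(** All terms are nonnegative, so changing each exponent by at most T changes the sum by a factor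
    between e^{-T} and e^T, whatever n and the weights are. *)
Lemma sum_exp_perturbation (n : nat) (w u eta : nat -> R) (T s : R) :
  (forall k, (k <= n)%nat -> 0 <= w k) ->
  (forall k, (k <= n)%nat -> Rabs (eta k) <= T) ->
  sum_f_R0 (fun k => w k * exp (u k + eta k)) n = s ->
  Rabs (sum_f_R0 (fun k => w k * exp (u k)) n - s) <= (exp T - 1) * s.
Proof.
  intros Hw He Hs.
  assert (Hs0 : 0 <= s).
  { rewrite <- Hs; apply sum_nonneg; intros k Hk.
    apply Rmult_le_pos; [apply Hw, Hk | apply Rlt_le, exp_pos]. }
  assert (HTT : exp T * exp (- T) = 1)
    by (rewrite <- exp_plus; replace (T + - T) with 0 by ring; apply exp_0).
  assert (Mono : forall x y, x <= y -> exp x <= exp y).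
  { intros x y [H | ->]; [apply Rlt_le, exp_increasing, H | lra]. }
  assert (U : sum_f_R0 (fun k => w k * exp (u k)) n <= exp T * s).
  { rewrite <- Hs, scal_sum; apply sum_Rle; intros k Hk.
    rewrite Rmult_assoc, <- exp_plus; apply Rmult_le_compat_l; [apply Hw, Hk |].
    apply Mono; specialize (He k Hk); apply Rabs_le_between in He; lra. }
  assert (L : exp (- T) * s <= sum_f_R0 (fun k => w k * exp (u k)) n).
  { rewrite <- Hs, scal_sum; apply sum_Rle; intros k Hk.
    rewrite Rmult_assoc, <- exp_plus; apply Rmult_le_compat_l; [apply Hw, Hk |].
    apply Mono; specialize (He k Hk); apply Rabs_le_between in He; lra. }
  assert (HT := exp_pos T); assert (HT' := exp_pos (- T)).
  (* The difference (e^T - 1) - (1 - e^{-T}) equals (e^T - 1)^2 e^{-T}. *)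
  assert (H2 : 1 - exp (- T) <= exp T - 1) 
    by (assert (H : 0 <= (exp T - 1) * (exp T - 1) * exp (- T)) by
          (apply Rmult_le_pos; [apply Rle_0_sqr | lra]); nra).
  apply Rabs_le; split; nra.
Qed.

(* Lambda_n = (l0, l1, l2, lam n 3, ..., lam n n); tail3 n = map (lam n) (seq 3 (n-2)) *)
Theorem mainTheorem18 (l0 l1 l2 a b M : R) (lam : nat -> nat -> Cx) :
  l0 < l1 -> l2 <> l0 -> l2 <> l1 -> a < b ->
  (forall n, (2 <= n)%nat ->
     closed_conj (RtoC l0 :: RtoC l1 :: RtoC l2 :: map (lam n) (seq 3 (n - 2)))) ->
  M > 0 ->
  (forall n j, (2 <= n)%nat -> (3 <= j <= n)%nat -> Rabs (cim (lam n j)) <= M) ->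
  b - a < PI / M ->
  (* uniform convergence t_k - t_{k-1} -> 0 *)
  (forall eps, eps > 0 -> exists N, forall n k, (2 <= n)%nat -> (N <= n)%nat ->
     (1 <= k <= n)%nat ->
     Rabs (node a b l0 l1 (RtoC l2 :: map (lam n) (seq 3 (n - 2))) k
           - node a b l0 l1 (RtoC l2 :: map (lam n) (seq 3 (n - 2))) (k - 1)) < eps) ->
  (* uniform convergence of log b(n,k) / (t_k - t_{k+1}) to l2 - l0 *)
  (forall eps, eps > 0 -> exists N, forall n k, (2 <= n)%nat -> (N <= n)%nat ->
     (k <= n - 1)%nat ->
     Rabs (ln (cre (limL (fun x =>
               Cdiv (bern a b (RtoC l0 :: RtoC l1 :: map (lam n) (seq 3 (n - 2))) k x)
                    (bern a b (RtoC l1 :: RtoC l2 :: map (lam n) (seq 3 (n - 2))) k x)) b))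
           / (node a b l0 l1 (RtoC l2 :: map (lam n) (seq 3 (n - 2))) k
              - node a b l0 l1 (RtoC l2 :: map (lam n) (seq 3 (n - 2))) (S k))
           - (l2 - l0)) < eps) ->
  forall f : R -> Cx, contC_on a b f ->
  forall eps, eps > 0 -> exists N, forall n x, (2 <= n)%nat -> (N <= n)%nat ->
    a <= x <= b ->
    Cmod (Csub (bernstein_op a b l0 l1 (RtoC l2 :: map (lam n) (seq 3 (n - 2))) f x) (f x))
      < eps.
Proof.
  intros H01 H20 H21 Hab Hcl HM Him HMab _ Hlog f Hf eps Heps.
  assert (Hadm : forall n, (2 <= n)%nat -> admissible a b M (map (lam n) (seq 3 (n - 2)))).
  { intros n Hn; split; [exact Hab | split; [exact HM | split]].
    - apply (Rmult_lt_compat_l M) in HMab; [| exact HM].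
      replace (M * (PI / M)) with PI in HMab by (field; lra); exact HMab.
    - apply closed_conj_paired; [lra | |].
      + intros z Hz; apply in_map_iff in Hz; destruct Hz as [j [<- Hj]].
        apply in_seq in Hj; apply Him; lia.
      (* The three fixed frequencies are real, so splitting them off leaves a list still closed
         under conjugation. *)
      + apply (closed_conj_app [RtoC l0; RtoC l1; RtoC l2]); [| apply Hcl, Hn].
        intros F; apply (applyOps_conj M); repeat constructor. }
  destruct (korovkin_exp a b l0 l1 l2 (fun x => cre (f x)) Hab H01 H20 H21) with (eps := eps / 2)
    as [tau1 [Htau1 K1]]; [| lra |].
  { intros x Hx e He; destruct (Hf x Hx e He) as [d [Hd H]]; exists d; split; [exact Hd |].
    intros y Hy Hyx; apply Rle_lt_trans with (2 := H y Hy Hyx).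
    apply (Rabs_cre_le (Csub (f y) (f x))). }
  destruct (korovkin_exp a b l0 l1 l2 (fun x => cim (f x)) Hab H01 H20 H21) with (eps := eps / 2)
    as [tau2 [Htau2 K2]]; [| lra |].
  { intros x Hx e He; destruct (Hf x Hx e He) as [d [Hd H]]; exists d; split; [exact Hd |].
    intros y Hy Hyx; apply Rle_lt_trans with (2 := H y Hy Hyx).
    apply (Rabs_cim_le (Csub (f y) (f x))). }
  (* With this T the relative error e^T - 1 is the smaller of the thresholds for the real and the
     imaginary part. *)
  set (T := ln (1 + Rmin tau1 tau2)).
  assert (Hmin : 0 < Rmin tau1 tau2) by (apply Rmin_glb_lt; assumption).
  assert (HT : 0 < T) by (rewrite <- ln_1; apply ln_increasing; lra).
  (* An error of T / (b - a) per unit length accumulates to at most T over [a,b]. *)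
  destruct (Hlog (T / (b - a))) as [N HN]; [apply Rdiv_lt_0_compat; lra |].
  exists N; intros n x Hn HnN Hx.
  destruct (bernstein_op_structure a b M l0 l1 l2 _ H01 (Hadm n Hn))
    as [w [Hw [Hinc [Hlast [S0 [S1 [S2 Hop]]]]]]].
  rewrite length_map, length_seq in *.
  replace (S (S (n - 2))) with n in * by lia.
  rewrite Hop by exact Hx.
  specialize (HN n); set (t := node a b l0 l1 (RtoC l2 :: map (lam n) (seq 3 (n - 2)))) in *.
  assert (Ht : forall k, (k <= n)%nat -> a <= t k <= b).
  { intros k Hk; rewrite <- Hlast; exact (increasing_steps t n Hinc k Hk). }
  specialize (S0 x Hx); specialize (S1 x Hx); specialize (S2 x Hx).
  apply (sum_exp_perturbation n (fun k => w k x) (fun k => l2 * t k) _ T) in S2.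
  - assert (ET : exp T - 1 = Rmin tau1 tau2) by (unfold T; rewrite exp_ln by lra; ring).
    rewrite ET in S2; assert (He := exp_pos (l2 * x)).
    assert (M1 := Rmin_l tau1 tau2); assert (M2 := Rmin_r tau1 tau2).
    apply Rle_lt_trans with (1 := Cmod_le_Rabs _); simpl.
    assert (E1 := K1 n t (fun k => w k x) x Hx (fun k Hk => Hw k x Hk Hx) Ht S0 S1 ltac:(nra)).
    assert (E2 := K2 n t (fun k => w k x) x Hx (fun k Hk => Hw k x Hk Hx) Ht S0 S1 ltac:(nra)).
    unfold Rminus in E1, E2; lra.
  - intros k Hk; apply Hw; assumption.
  - intros k Hk; apply Rle_trans with (T / (b - a) * (t k - t 0%nat)).
    + apply (prefix_sum_bound _ t _ n); [| exact Hk]; intros j Hj.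
      specialize (HN j Hn HnN ltac:(lia)); specialize (Hinc j Hj).
      set (q := cre (limL _ _)) in *.
      (* Since t_j < t_{j+1}, the deviation of the quotient from l2 - l0 becomes an error
         proportional to the step. *)
      replace (- ln q - (l2 - l0) * (t (S j) - t j))
        with ((ln q / (t j - t (S j)) - (l2 - l0)) * (t (S j) - t j)) by (field; lra).
      rewrite Rabs_mult, (Rabs_pos_eq (t (S j) - t j)) by lra.
      apply Rmult_le_compat_r; lra.
    + apply Rle_trans with (T / (b - a) * (b - a)); [| right; field; lra].
      apply Rmult_le_compat_l; [apply Rlt_le, Rdiv_lt_0_compat; lra |].
      change (t 0%nat) with a; specialize (Ht k Hk); lra.
Qed.
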